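(* (i) There are absolute constants $c_1,c_2>0$ such that $c_1 H\log H \le R_2(1,H) \le c_2 H\log H$ for every integer $H\ge 2$, and $c_1 H^{1/2} \le R_2(2,H)\le c_2 H^{1/2}$ for every integer $H \ge 1$. (ii) For any integers $n \ge 3$ and $k$ with $1 \le k\le n$ there is a constant $c>0$ depending only on $n$ and $k$ such that for every integer $H\ge 1$ $$R_n(k,H) \le c\, H^{n-(k+1)/2}.$$ (iii) For any integers $n\ge 3$ and $k$ with $1\le k\le n$, except when $k=n$ is even, there is a constant $c'>0$ depending only on $n$ and $k$ such that for every integer $H\ge 1$ $$R_n(k,H)\ge c'\,H^{e(n,k)}.$$ (iv) For any even integer $n \ge 3$ (the case $k=n$ even) there is a constant $c''>0$ depending only on $n$ such that for every integer $H\ge 1$ $$R_n(n,H)\ge c''\,H^{\frac n8+\frac2n-\frac14}.$$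
   Context: For a polynomial $f$ of degree $n \ge 1$ over $\mathbb{C}$ with roots $\alpha_1,\dots,\alpha_n$ (listed with multiplicity), put $r(f)=\max_{1\le i\le n}|\alpha_i|$. The roots of $f$ of maximal modulus are the roots of modulus $r(f)$; they are always counted with multiplicity. The height of $f$ is the maximum of the absolute values of its coefficients (including the leading one). For positive integers $k\le n$ and $H$, $R_n(k,H)$ denotes the number of monic integer polynomials $f$ of degree $n$ and height at most $H$ that are reducible in $\mathbb{Z}[x]$ and have exactly $k$ roots of maximal modulus. The exponent $e(n,k)$ is defined by $$e(n,k)=\begin{cases}\frac{n+1}{2}-k+\frac{5k^2-4k+7}{8n} & \text{if } k \text{ is odd},\\[2pt] \frac{n+1}{2}-k+\frac{5k^2-2k+16}{8n} & \text{if } k\text{ is even}.\end{cases}$$ *)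

(* Defs.v *)
From HB Require Import structures.
From mathcomp Require Import all_boot all_order all_algebra finmap.
From mathcomp Require Import all_classical all_reals all_analysis.
From mathcomp Require Import complex zify.

Set Implicit Arguments.
Unset Strict Implicit.
Unset Printing Implicit Defensive.

Import Order.TTheory GRing.Theory Num.Theory.

Local Open Scope classical_set_scope.
Local Open Scope ring_scope.
Local Open Scope complex_scope.

Section Roots.
Variable R : realType.

(* With multiplicity, in an order chosen by the library. *)
Definition croots (p : {poly R[i]}) : seq R[i] :=
  sval (closed_field_poly_normal p).

Lemma crootsE (p : {poly R[i]}) :
  p = lead_coef p *: \prod_(z <- croots p) ('X - z%:P).
Proof. exact: (svalP (closed_field_poly_normal p)). Qed.

(* The norm of R[i] is valued in R[i]; Normc.normc is its R-valued version. *)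
Definition max_modulus (p : {poly R[i]}) : R :=
  \big[Num.max/0]_(z <- croots p) Normc.normc z.

Definition nb_max_roots (p : {poly R[i]}) : nat :=
  count (fun z => Normc.normc z == max_modulus p) (croots p).

End Roots.

Definition height (f : {poly int}) : nat := (\max_(i < size f) `|(f`_i)%R|)%N.

(* Reducibility in the ring Z[x], as opposed to Q[x]. *)
Definition reducible (f : {poly int}) : Prop :=
  f != 0 /\ exists g h : {poly int},
    [/\ g \isn't a GRing.unit, h \isn't a GRing.unit & f = g * h].

Definition reducible_set (R : realType) (n k H : nat) : set {poly int} :=
  [set f : {poly int} | [/\ f \is monic, size f = n.+1, (height f <= H)%N,
     reducible f & nb_max_roots (map_poly (intr : int -> R[i]) f) = k]].

Definition Rcount (R : realType) (n k H : nat) : nat :=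
  #|` fset_set (reducible_set R n k H) |.

(* fset_set sends an infinite set to the empty one; this is not at play here. *)
Lemma finite_reducible_set (R : realType) (n k H : nat) :
  finite_set (reducible_set R n k H).
Proof.
pose F (a : {ffun 'I_n.+1 -> 'I_(H + H).+1}) : {poly int} :=
  \poly_(i < n.+1) ((a (inord i))%:Z - H%:Z).
apply: (@sub_finite_set _ _ (range F)); last first.
  exact/finite_image/finite_finset.
move=> f [_ sf hf _ _].
have hc i : (`|(f`_i)%R| <= H)%N.
  have [ilt|ige] := ltnP i (size f); last by rewrite nth_default.
  apply: leq_trans hf.
  by have := leq_bigmax (F := fun j : 'I_(size f) => `|(f`_j)%R|%N) (Ordinal ilt).
exists [ffun i : 'I_n.+1 => inord `|(f`_i + H%:Z)%R|%N] => //.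
apply/polyP => i; rewrite coef_poly.
case: ltnP => [ilt|ige]; last by rewrite nth_default // sf.
rewrite ffunE (inordK ilt) inordK; last by have := hc i; lia.
by have := hc i; lia.
Qed.

Definition e_exp (R : realType) (n k : nat) : R :=
  if odd k then
    (n%:R + 1) / 2 - k%:R + (5 * k%:R ^+ 2 - 4 * k%:R + 7) / (8 * n%:R)
  else
    (n%:R + 1) / 2 - k%:R + (5 * k%:R ^+ 2 - 2 * k%:R + 16) / (8 * n%:R).

(* Main.v *)
(* A factorization f = g h of a monic polynomial of height at most H satisfies
M(g) M(h) <= n! H, where M is the product of max(1, |root|); a coefficient of g
is at most 2^n M(g), and the coefficient of x^(deg g - j) is at most 2^n r^j
when the roots have modulus at most r.

Upper bounds.  If g has no root of maximal modulus r(f), one sums over g,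
according to its height, the number of possible h.  If both factors have such
roots and k < n, one counts pairs with r(f) and M(g) in given dyadic intervals
(or, when g is linear, with g given); the number of dyadic cells is absorbed by
a saving of r(f) <= (n! H)^(1/k).  If k = n, then |g(0)| = r^(deg g) determines
r, hence the constant terms up to sign.

Lower bounds.  Take f = L G h, where the roots of L and G all have modulus s
with s^2 = A an integer, and h has small coefficients, so that its roots have
modulus less than s.  Here G = x^m Q(x + A/x), where Q is an integral
perturbation of a polynomial with m simple roots in ]0, s[, so that Q has m
real roots in [-2 s, 2 s].  The factor L is 1, x - t (with A = t^2) or x^2 - t
(with A = t).  The parameters of f are recovered from its roots of maximal
modulus. *)
Require Import Defs.
From mathcomp Require Import all_boot all_order all_algebra finmap.
From mathcomp Require Import all_classical all_reals all_analysis.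
From mathcomp Require Import complex zify ring lra.

Set Implicit Arguments.
Unset Strict Implicit.
Unset Printing Implicit Defensive.

Import Order.TTheory GRing.Theory Num.Theory.

Local Open Scope ring_scope.

(** Put y = (n! H)^(1/k). Bounding the j-th coefficient after the leading one by r(f)^j for j <= k
    and by M(f) beyond, up to constants, only gives O(y^(k n - C(k,2))) polynomials, that is O(H^(n
    - (k-1)/2)). Reducibility has to save exactly a factor H, without losing a logarithm. The
    critical case is a linear factor whose root is not of maximal modulus: the sum over its constant
    term c is comparable to the sum of |c|^(-e/k), with e >= 3k/2 once n >= 3. For n = 2 and k = 1
    the same sum is harmonic, whence the logarithm in (i). For the lower bounds s is of order
    H^(1/n), and Q and h vary in boxes of about s^(m (m+1)/2) and s^(d (d+1)/2) elements, where d =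
    deg h. Square roots of integers provide about s^2 values of s, integers only about s. But the
    roots of G come in pairs, so an odd k requires the linear L and hence an integer s. For k = n
    even there is no h, and L = x^2 - t is what makes f reducible, at the cost of one degree of
    Q. *)

Local Notation nc := Normc.normc.

(** * Roots, Mahler measure and coefficients *)

Lemma normc_ge0 (R : realType) (z : R[i]) : 0 <= nc z :> R.
Proof. by case: z => x y; rewrite /Normc.normc sqrtr_ge0. Qed.

Lemma ler_normcD (R : realType) (x y : R[i]) : nc (x + y) <= nc x + nc y :> R.
Proof. exact: (@le_normcD R x y). Qed.

Lemma normc_opp (R : realType) (x : R[i]) : nc (- x) = nc x.
Proof. exact: (@normcN R x). Qed.

Lemma normc_real (R : realType) (x : R) : nc (x%:C)%C = `|x|.
Proof. by rewrite /Normc.normc /= expr0n addr0 sqrtr_sqr. Qed.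

Lemma normc_int (R : realType) (m : int) : nc (m%:~R : R[i]) = `|m|%N%:R :> R.
Proof.
have -> : (m%:~R : R[i]) = ((m%:~R : R)%:C)%C by rewrite rmorph_int.
by rewrite normc_real -intr_norm natr_absz.
Qed.

Lemma nc0 (R : realType) : nc (0 : R[i]) = 0 :> R.
Proof. exact: Normc.normc0. Qed.

Lemma nc1 (R : realType) : nc (1 : R[i]) = 1 :> R.
Proof. exact: Normc.normc1. Qed.

Lemma normc_prod (R : realType) (T : Type) (s : seq T) (F : T -> R[i]) :
  nc (\prod_(z <- s) F z) = \prod_(z <- s) nc (F z) :> R.
Proof.
elim: s => [|a s IH]; first by rewrite !big_nil nc1.
by rewrite !big_cons Normc.normcM IH.
Qed.

Definition rootpoly (R : realType) (s : seq R[i]) : {poly R[i]} :=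
  \prod_(z <- s) ('X - z%:P).

Definition mahler (R : realType) (s : seq R[i]) : R :=
  \prod_(z <- s) Num.max 1 (nc z).

Lemma coef_XsubC_mul (A : comNzRingType) (c : A) (p : {poly A}) (i : nat) :
  (('X - c%:P) * p)`_i = (if i is j.+1 then p`_j else 0) - c * p`_i.
Proof. by rewrite mulrBl coefB coefXM coefCM; case: i. Qed.

Lemma normc_coef_rootpoly_pow (R : realType) (rho : R) (s : seq R[i]) (i : nat) :
  0 <= rho -> (forall z, z \in s -> nc z <= rho) ->
  nc (rootpoly s)`_i <= 2 ^+ size s * rho ^+ (size s - i).
Proof.
move=> rho0; elim: s i => [|z s IH] i hs.
  rewrite /rootpoly big_nil coef1 sub0n !expr0 mulr1.
  by case: i => [|i]; rewrite ?nc1 // nc0.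
have hz : nc z <= rho by apply: hs; rewrite mem_head.
have {}IH j : nc (rootpoly s)`_j <= 2 ^+ size s * rho ^+ (size s - j).
  by apply: IH => y ys; apply: hs; rewrite in_cons ys orbT.
rewrite /rootpoly big_cons -/(rootpoly s) coef_XsubC_mul.
apply: (le_trans (ler_normcD _ _)); rewrite normc_opp Normc.normcM.
rewrite [size (z :: s)]/= [in leRHS]exprS -mulrA mulr2n mulrDl mul1r.
apply: lerD.
  case: i => [|i]; last by rewrite subSS.
  by rewrite nc0 mulr_ge0 ?exprn_ge0.
have [lei|lti] := leqP i (size s).
  rewrite subSn // exprS mulrCA; apply: ler_pM; rewrite ?normc_ge0 //.
rewrite nth_default ?nc0 ?mulr0 ?mulr_ge0 ?exprn_ge0 //.
by rewrite size_prod_XsubC.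
Qed.

Lemma mahler_ge1 (R : realType) (s : seq R[i]) : 1 <= mahler s.
Proof.
rewrite /mahler; elim: s => [|z s IH]; first by rewrite big_nil.
by rewrite big_cons mulr_ege1 // le_max lexx.
Qed.

Lemma mahler_gt0 (R : realType) (s : seq R[i]) : 0 < mahler s.
Proof. exact: lt_le_trans ltr01 (mahler_ge1 s). Qed.

Lemma mahler_cat (R : realType) (s t : seq R[i]) :
  mahler (s ++ t) = mahler s * mahler t.
Proof. by rewrite /mahler big_cat. Qed.

Lemma mahler_perm (R : realType) (s t : seq R[i]) :
  perm_eq s t -> mahler s = mahler t.
Proof. by move=> st; rewrite /mahler; apply: perm_big. Qed.

Lemma normc_coef_rootpoly_mahler (R : realType) (s : seq R[i]) (i : nat) :
  nc (rootpoly s)`_i <= 2 ^+ size s * mahler s.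
Proof.
elim: s i => [|z s IH] i.
  rewrite /rootpoly /mahler !big_nil coef1 expr0 mulr1.
  by case: i => [|i]; rewrite ?nc1 // nc0.
rewrite /rootpoly big_cons -/(rootpoly s) coef_XsubC_mul.
apply: (le_trans (ler_normcD _ _)); rewrite normc_opp Normc.normcM.
rewrite [size (z :: s)]/= [in leRHS]exprS -mulrA mulr2n mulrDl mul1r.
have -> : mahler (z :: s) = Num.max 1 (nc z) * mahler s.
  by rewrite /mahler big_cons.
have B0 : 0 <= 2 ^+ size s * mahler s :> R.
  by rewrite mulr_ge0 ?exprn_ge0 // ltW ?mahler_gt0.
rewrite mulrCA; apply: lerD.
  apply: (@le_trans _ _ (2 ^+ size s * mahler s)).
    by case: i => // ; rewrite nc0.
  by rewrite ler_peMl // le_max lexx.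
by apply: ler_pM; rewrite ?normc_ge0 // le_max lexx orbT.
Qed.

(* Dividing by [X - z] costs a factor [n / max 1 |z|]: solve the recursion for
   the coefficients downwards if [|z| <= 1], upwards otherwise. *)
Lemma coef_divXsubC_le (R : realType) (z : R[i]) (p : {poly R[i]}) (n : nat) (B : R) :
  (size p <= n)%N -> (forall i, nc (('X - z%:P) * p)`_i <= B) ->
  forall i, Num.max 1 (nc z) * nc p`_i <= n%:R * B.
Proof.
move=> sp hB.
have B0 : 0 <= B by apply: le_trans (hB 0%N); apply: normc_ge0.
have [z1|z1] := leP (nc z) 1.
  have down j : nc p`_(n - j) <= j%:R * B.
    elim: j => [|j IH]; first by rewrite subn0 nth_default // nc0 mul0r.
    have [jn|nj] := ltnP j n; last first.
      have -> : (n - j.+1 = n - j)%N by lia.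
      apply: (le_trans IH); rewrite ler_wpM2r // ler_nat; lia.
    have := hB (n - j)%N; rewrite coef_XsubC_mul.
    have -> : (n - j = (n - j.+1).+1)%N by lia.
    set u := p`_(n - j.+1); set v := p`_ _ => h.
    have -> : u = (u - z * v) + z * v by rewrite subrK.
    apply: (le_trans (ler_normcD _ _)); rewrite -natr1 mulrDl mul1r addrC.
    apply: lerD => //; rewrite Normc.normcM.
    apply: (@le_trans _ _ (1 * nc v)).
      by rewrite ler_wpM2r ?normc_ge0.
    by rewrite mul1r /v; move: IH; have -> : (n - j = (n - j.+1).+1)%N by lia.
  move=> i; rewrite mul1r.
  have [ilt|ige] := ltnP i n; last first.
    by rewrite nth_default ?nc0 ?mulr_ge0 // (leq_trans sp).
  have -> : i = (n - (n - i))%N by lia.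
  apply: (le_trans (down _)); rewrite ler_wpM2r // ler_nat; lia.
have up j : nc z * nc p`_j <= j.+1%:R * B.
  elim: j => [|j IH].
    have := hB 0%N; rewrite coef_XsubC_mul sub0r normc_opp Normc.normcM.
    by rewrite mul1r.
  have := hB j.+1; rewrite coef_XsubC_mul => h.
  have -> : nc z * nc p`_j.+1 = nc (p`_j - (p`_j - z * p`_j.+1)).
    by rewrite subKr Normc.normcM.
  apply: (le_trans (ler_normcD _ _)); rewrite normc_opp.
  rewrite -[j.+2%:R]natr1 mulrDl mul1r; apply: lerD => //.
  by apply: le_trans IH; rewrite ler_peMl ?normc_ge0 // ltW.
move=> i; have [ilt|ige] := ltnP i n; last first.
  by rewrite nth_default ?nc0 ?mulr0 ?mulr_ge0 // (leq_trans sp).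
by apply: (le_trans (up i)); rewrite ler_wpM2r // ler_nat.
Qed.

(** An elementary substitute for Landau's inequality: the roots are divided out one at a time with
    [coef_divXsubC_le], and the factors lost at each division multiply to the factorial. *)
Lemma mahler_le (R : realType) (s : seq R[i]) (B : R) :
  (forall i, nc (rootpoly s)`_i <= B) -> mahler s <= (size s)`!%:R * B.
Proof.
elim: s B => [|z s IH] B hB.
  move: (hB 0%N); rewrite /rootpoly /mahler !big_nil coef1 nc1.
  by rewrite fact0 mul1r.
have -> : mahler (z :: s) = Num.max 1 (nc z) * mahler s.
  by rewrite /mahler big_cons.
have m0 : 0 < Num.max 1 (nc z) by rewrite lt_max ltr01.
have h1 := @coef_divXsubC_le R z (rootpoly s) (size s).+1 B.
have {}h1 : forall i, Num.max 1 (nc z) * nc (rootpoly s)`_i <= (size s).+1%:R * B.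
  apply: h1; first by rewrite size_prod_XsubC.
  by move=> i; have := hB i; rewrite /rootpoly big_cons.
have : mahler s <= (size s)`!%:R * ((size s).+1%:R * B / Num.max 1 (nc z)).
  by apply: IH => i; rewrite ler_pdivlMr // mulrC.
rewrite !mulrA ler_pdivlMr // mulrC [size (z :: s)]/= factS natrM.
by rewrite [(_ * (size s)`!%:R)]mulrC.
Qed.

(** * Complex roots of monic integer polynomials *)

Definition intpoly (R : realType) (f : {poly int}) : {poly R[i]} :=
  map_poly (intr : int -> R[i]) f.

Definition zroots (R : realType) (f : {poly int}) : seq R[i] :=
  croots (intpoly R f).

Lemma intr_complex_inj (R : realType) : injective (intr : int -> R[i]).
Proof. by move=> x y /intr_inj. Qed.

Lemma intpoly_inj (R : realType) : injective (intpoly R).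
Proof.
move=> f g /polyP fg; apply/polyP => i; have := fg i.
by rewrite !coef_map_id0 // => /intr_complex_inj.
Qed.

Lemma intpolyM (R : realType) (f g : {poly int}) :
  intpoly R (f * g) = intpoly R f * intpoly R g.
Proof. exact: rmorphM. Qed.

Lemma size_intpoly (R : realType) (f : {poly int}) : size (intpoly R f) = size f.
Proof. by apply: size_map_inj_poly => //; apply: intr_complex_inj. Qed.

Lemma intpolyE (R : realType) (f : {poly int}) :
  f \is monic -> intpoly R f = rootpoly (zroots R f).
Proof.
move=> fm; have := crootsE (intpoly R f).
rewrite lead_coef_map_inj ?(monicP fm) ?scale1r //; exact: intr_complex_inj.
Qed.

Lemma size_zroots (R : realType) (f : {poly int}) :
  f \is monic -> size f = (size (zroots R f)).+1.
Proof.
by move=> fm; rewrite -(size_intpoly R) intpolyE // size_prod_XsubC.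
Qed.

Lemma perm_zroots (R : realType) (f : {poly int}) (s : seq R[i]) :
  f \is monic -> intpoly R f = rootpoly s -> perm_eq (zroots R f) s.
Proof. by move=> fm; rewrite intpolyE // => /prod_XsubC_eq. Qed.

Lemma rootpoly_cat (R : realType) (s t : seq R[i]) :
  rootpoly (s ++ t) = rootpoly s * rootpoly t.
Proof. by rewrite /rootpoly big_cat. Qed.

Lemma perm_zrootsM (R : realType) (f g : {poly int}) :
  f \is monic -> g \is monic ->
  perm_eq (zroots R (f * g)) (zroots R f ++ zroots R g).
Proof.
move=> fm gm; apply: perm_zroots; first by rewrite monicMl.
by rewrite intpolyM rootpoly_cat !intpolyE.
Qed.

Lemma normc_coef_intpoly (R : realType) (f : {poly int}) (i : nat) :
  nc (intpoly R f)`_i = `|(f`_i)%R|%N%:R :> R.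
Proof. by rewrite coef_map_id0 // normc_int. Qed.

Lemma abscoef_le_mahler (R : realType) (f : {poly int}) (n i : nat) :
  f \is monic -> size f = n.+1 ->
  `|(f`_i)%R|%N%:R <= 2 ^+ n * mahler (zroots R f).
Proof.
move=> fm; rewrite (size_zroots R fm) => -[<-]; rewrite -normc_coef_intpoly.
by rewrite intpolyE // normc_coef_rootpoly_mahler.
Qed.

Lemma abscoef_le_pow (R : realType) (f : {poly int}) (n i : nat) (rho : R) :
  f \is monic -> size f = n.+1 -> 0 <= rho ->
  (forall z, z \in zroots R f -> nc z <= rho) ->
  `|(f`_i)%R|%N%:R <= 2 ^+ n * rho ^+ (n - i).
Proof.
move=> fm; rewrite (size_zroots R fm) => -[<-] r0 hr.
by rewrite -normc_coef_intpoly intpolyE // normc_coef_rootpoly_pow.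
Qed.

Lemma abscoef_le_height (f : {poly int}) (i : nat) :
  (`|(f`_i)%R| <= height f)%N.
Proof.
have [ilt|ige] := ltnP i (size f); last by rewrite nth_default.
by have := leq_bigmax (F := fun j : 'I_(size f) => `|(f`_j)%R|%N) (Ordinal ilt).
Qed.

Lemma height_le (f : {poly int}) (H : nat) :
  (forall i, (`|(f`_i)%R| <= H)%N) -> (height f <= H)%N.
Proof. by move=> h; apply/bigmax_leqP => i _. Qed.

Lemma mahler_le_height (R : realType) (f : {poly int}) (n : nat) :
  f \is monic -> size f = n.+1 ->
  mahler (zroots R f) <= n`!%:R * (height f)%:R.
Proof.
move=> fm; rewrite (size_zroots R fm) => -[<-]; apply: mahler_le => i.
by rewrite -intpolyE // normc_coef_intpoly ler_nat abscoef_le_height.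
Qed.

(** Agrees with [max_modulus] by conversion; as a function of the list of roots, it can be computed
    from any enumeration of them. *)
Definition maxnorm (R : realType) (s : seq R[i]) : R :=
  \big[Num.max/0]_(z <- s) nc z.

Lemma maxnorm_cons (R : realType) (z : R[i]) (s : seq R[i]) :
  maxnorm (z :: s) = Num.max (nc z) (maxnorm s).
Proof. by rewrite /maxnorm big_cons. Qed.

Lemma maxnorm_ge (R : realType) (s : seq R[i]) (z : R[i]) :
  z \in s -> nc z <= maxnorm s.
Proof.
elim: s => // a s IH; rewrite in_cons maxnorm_cons le_max.
by case/orP => [/eqP->|/IH->]; rewrite ?lexx ?orbT.
Qed.

Lemma maxnorm_eq (R : realType) (s : seq R[i]) (r : R) :
  (exists2 z, z \in s & nc z = r) -> (forall z, z \in s -> nc z <= r) ->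
  maxnorm s = r.
Proof.
move=> [z zs zr] hr; apply/le_anti/andP; split; last by rewrite -zr maxnorm_ge.
have r0 : 0 <= r by rewrite -zr normc_ge0.
elim: s hr {zs} => [|a s IH] hr; first by rewrite /maxnorm big_nil.
rewrite maxnorm_cons ge_max hr ?mem_head //= IH // => y ys.
by rewrite hr // in_cons ys orbT.
Qed.

Lemma nb_max_rootsE (R : realType) (f : {poly int}) :
  nb_max_roots (intpoly R f) =
  count (fun z => nc z == maxnorm (zroots R f)) (zroots R f).
Proof. by []. Qed.

Lemma mahler_ge_pow (R : realType) (s : seq R[i]) (r : R) :
  Num.max 1 r ^+ count (fun z => nc z == r) s <= mahler s.
Proof.
elim: s => [|z s IH]; first by rewrite expr0 mahler_ge1.
have -> : mahler (z :: s) = Num.max 1 (nc z) * mahler s.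
  by rewrite /mahler big_cons.
rewrite /=; case: eqP => [->|_].
  by rewrite add1n exprS ler_wpM2l // le_max ler01.
rewrite add0n; apply: (le_trans IH); rewrite ler_peMl ?le_max ?lexx //.
by rewrite ltW ?mahler_gt0.
Qed.

Lemma monic_nonunit_size (g : {poly int}) :
  g \is monic -> g \isn't a GRing.unit -> (2 <= size g)%N.
Proof.
move=> gm; apply: contraR; rewrite -leqNgt => sg.
have s1 : size g = 1%N.
  by apply/eqP; rewrite eqn_leq sg lt0n size_poly_eq0 monic_neq0.
rewrite poly_unitE s1 eqxx /=; have := monicP gm.
by rewrite lead_coefE s1 /= => ->.
Qed.

Lemma size_monic_nonunit (g : {poly int}) :
  (2 <= size g)%N -> g \isn't a GRing.unit.
Proof. by rewrite poly_unitE; case: eqP => // ->. Qed.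

(** The leading coefficients of the two factors have product 1 in Z, so both are 1 or both are -1;
    in the second case both factors change sign. A monic polynomial that is not a unit is not
    constant. *)
Lemma monic_reducibleP (f : {poly int}) : f \is monic ->
  reducible f <-> exists g h : {poly int}, [/\ g \is monic, h \is monic,
    (2 <= size g)%N, (2 <= size h)%N & f = g * h].
Proof.
move=> fm; split; last first.
  move=> [g [h [gm hm sg sh fE]]]; split; first exact: monic_neq0.
  by exists g, h; split; rewrite ?size_monic_nonunit.
move=> [f0 [g [h [gu hu fE]]]].
have lu : lead_coef g * lead_coef h = 1 by rewrite -lead_coefM -fE (monicP fm).
have : (lead_coef g == 1) || (lead_coef g == -1).
  have : lead_coef g \is a GRing.unit by apply/unitrP; exists (lead_coef h); rewrite mulrC.
  by rewrite qualifE.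
case/orP => /eqP lg; rewrite lg ?mul1r ?mulN1r in lu.
  have gm : g \is monic by apply/monicP.
  have hm : h \is monic by apply/monicP.
  by exists g, h; split=> //; apply: monic_nonunit_size.
have gm : - g \is monic by apply/monicP; rewrite lead_coefN lg opprK.
have hm : - h \is monic by apply/monicP; rewrite lead_coefN.
exists (- g), (- h); split=> //; last by rewrite mulrNN.
  by apply: monic_nonunit_size; rewrite ?unitrN.
by apply: monic_nonunit_size; rewrite ?unitrN.
Qed.

(* Used with [g] a factor of [f] and [r] the maximal modulus of the roots of
   [f]. *)
Definition factor_type (R : realType) (r : R) (a p : nat) (g : {poly int}) :=
  [/\ g \is monic, size g = a.+1,
      forall z, z \in zroots R g -> nc z <= r
    & count (fun z => nc z == r) (zroots R g) = p].

Lemma reducible_set_factor (R : realType) (n k H : nat) (f : {poly int}) :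
  reducible_set R n k H f ->
  exists (g h : {poly int}) (a b p q : nat) (r : R),
    [/\ f = g * h, [/\ (0 < a)%N, (0 < b)%N, (a + b = n)%N & (p + q = k)%N],
        factor_type r a p g, factor_type r b q h & 
        mahler (zroots R g) * mahler (zroots R h) <= n`!%:R * H%:R].
Proof.
move=> [fm sf hf /(monic_reducibleP fm)[g [h [gm hm sg sh fE]]] kf].
have perm := perm_zrootsM R gm hm.
rewrite -fE in perm.
have sE : (size (zroots R g) + size (zroots R h) = n)%N.
  have := perm_size perm; rewrite size_cat => <-.
  by have := size_zroots R fm; rewrite sf => -[].
exists g, h, (size (zroots R g)), (size (zroots R h)).
exists (count (fun z => nc z == maxnorm (zroots R f)) (zroots R g)).
exists (count (fun z => nc z == maxnorm (zroots R f)) (zroots R h)).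
exists (maxnorm (zroots R f)); split=> //.
- split=> //.
  + by rewrite -ltnS -size_zroots.
  + by rewrite -ltnS -size_zroots.
  + by rewrite -count_cat -(permP perm) -nb_max_rootsE.
- split=> // [|z zg]; first exact: size_zroots.
  by apply: maxnorm_ge; rewrite (perm_mem perm) mem_cat zg.
- split=> // [|z zg]; first exact: size_zroots.
  by apply: maxnorm_ge; rewrite (perm_mem perm) mem_cat zg orbT.
rewrite -mahler_cat -(mahler_perm perm).
apply: (le_trans (mahler_le_height R fm sf)).
by rewrite ler_wpM2l // ler_nat.
Qed.

(** * Counting by covers *)

(** States that [S] has at most [x] elements, in a form that composes for arbitrary predicates; [x]
    is real, so that no bound has to be rounded. *)
Definition covered (R : realType) (T : eqType) (S : T -> Prop) (x : R) : Prop :=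
  exists2 s : seq T, forall t, S t -> t \in s & (size s)%:R <= x.

Lemma covered_sub (R : realType) (T : eqType) (S S' : T -> Prop) (x y : R) :
  (forall t, S t -> S' t) -> covered S' x -> x <= y -> covered S y.
Proof.
move=> SS' [s hs sx] xy; exists s; last exact: le_trans xy.
by move=> t /SS' /hs.
Qed.

(** Lets a proof assume an element of [S], from which it extracts inequalities between the
    parameters of [S]. *)
Lemma covered_nonempty (R : realType) (T : eqType) (S : T -> Prop) (x : R) :
  0 <= x -> ((exists t, S t) -> covered S x) -> covered S x.
Proof.
move=> x0 h; have [ne|ne] := pselect (exists t, S t); first exact: h.
by exists [::] => // t St; case: ne; exists t.
Qed.

Lemma covered_or (R : realType) (T : eqType) (S S' : T -> Prop) (x y : R) :
  covered S x -> covered S' y -> covered (fun t => S t \/ S' t) (x + y).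
Proof.
move=> [s hs sx] [s' hs' sy]; exists (s ++ s').
  by move=> t [/hs ts|/hs' ts]; rewrite mem_cat ts ?orbT.
by rewrite size_cat natrD lerD.
Qed.

Lemma covered_bigcup (R : realType) (I T : eqType) (r : seq I)
    (S : I -> T -> Prop) (x : I -> R) :
  (forall i, i \in r -> covered (S i) (x i)) ->
  covered (fun t => exists2 i, i \in r & S i t) (\sum_(i <- r) x i).
Proof.
elim: r => [|i r IH] h; first by rewrite big_nil; exists [::] => // t [].
rewrite big_cons; apply: (@covered_sub _ _ _
  (fun t => S i t \/ exists2 i, i \in r & S i t) (x i + \sum_(j <- r) x j)) => //.
  move=> t [j]; rewrite in_cons => /orP[/eqP->|jr] Sj; first by left.
  by right; exists j.
apply: covered_or; first by apply: h; rewrite mem_head.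
by apply: IH => j jr; apply: h; rewrite in_cons jr orbT.
Qed.

Lemma covered_bind (R : realType) (I T : eqType) (U : I -> Prop)
    (S : I -> T -> Prop) (x y : R) :
  0 <= y -> covered U x -> (forall i, U i -> covered (S i) y) ->
  covered (fun t => exists2 i, U i & S i t) (x * y).
Proof.
(* The list [r] may contain elements outside of [U], about which [h] says nothing; [S'] makes their
   sets empty. *)
move=> y0 [r hr rx] h; pose S' i t := U i /\ S i t.
apply: (@covered_sub _ _ _ (fun t => exists2 i, i \in r & S' i t)
  (\sum_(i <- r) y)).
- by move=> t [i Ui Sit]; exists i; [exact: hr|split].
- apply: covered_bigcup => i _; apply: covered_nonempty => // -[t [Ui _]].
  by apply: (@covered_sub _ _ _ (S i) y) => //; [move=> ? []|exact: h].
by rewrite big_const_seq count_predT iter_addr addr0 -mulr_natl ler_wpM2r.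
Qed.

Lemma covered_image2 (R : realType) (I J T : eqType) (A : I -> Prop)
    (B : J -> Prop) (F : I -> J -> T) (x y : R) :
  covered A x -> covered B y ->
  covered (fun t => exists i j, [/\ A i, B j & t = F i j]) (x * y).
Proof.
move=> cA [s hs sy]; have y0 : 0 <= y by apply: le_trans sy.
apply: (@covered_sub _ _ _
  (fun t => exists2 i, A i & exists2 j, B j & t = F i j) (x * y)) => //.
  by move=> t [i [j [Ai Bj tE]]]; exists i => //; exists j.
apply: covered_bind => // i _; exists [seq F i j | j <- s].
  by move=> t [j /hs js ->]; apply: map_f.
by rewrite size_map.
Qed.

Lemma covered_int_le (R : realType) (x : R) :
  1 <= x -> covered (fun c : int => `|c|%N%:R <= x) (3 * x).
Proof.
move=> x1; have x0 : 0 <= x by apply: le_trans x1.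
pose m := Num.truncn x.
exists ([seq Posz i | i <- iota 0 m.+1] ++ [seq - Posz i | i <- iota 1 m]).
  move=> c cx; have {cx}cm : (`|c| <= m)%N by rewrite truncn_ge_nat.
  rewrite mem_cat; case: (intP c) cm => [|n|n] cm; apply/orP.
  - by left; apply/mapP; exists 0%N; rewrite ?mem_iota.
  - by left; apply/mapP; exists n.+1; rewrite ?mem_iota //; lia.
  - by right; apply/mapP; exists n.+1; rewrite ?mem_iota //; lia.
rewrite size_cat !size_map !size_iota.
have mx : m%:R <= x by rewrite truncn_le.
rewrite natrD -[m.+1%:R]natr1; lra.
Qed.

Lemma covered_int_abs (R : realType) (x : R) :
  covered (fun c : int => `|c|%N%:R = x) (2 : R).
Proof.
exists [:: Posz (Num.truncn x); - Posz (Num.truncn x)] => // c <-.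
by rewrite natrK !in_cons; lia.
Qed.

Lemma covered_monic_box (R : realType) (a : nat) (C : nat -> int -> Prop)
    (x : nat -> R) :
  (forall i, (i < a)%N -> covered (C i) (x i)) ->
  covered (fun g : {poly int} => [/\ g \is monic, size g = a.+1 &
    forall i, (i < a)%N -> C i g`_i]) (\prod_(i < a) x i).
Proof.
elim: a C x => [|a IH] C x h.
  rewrite big_ord0; exists [:: 1] => // g [gm sg _].
  have /eqP := monicP gm; rewrite lead_coefE sg /= => /eqP g0.
  rewrite inE; apply/eqP/polyP => i; rewrite coef1; case: i => [|i] //=.
  by rewrite nth_default // sg.
rewrite big_ord_recl /=.
pose F (c : int) (g : {poly int}) : {poly int} := g * 'X + c%:P.
have cov : forall i, (i < a)%N -> covered (C i.+1) (x i.+1) by move=> i ia; apply: h.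
apply: (covered_sub _ (covered_image2 F (h 0%N isT)
  (IH (fun i => C i.+1) (fun i => x i.+1) cov))) => //.
move=> g [gm sg gC]; exists g`_0, (drop_poly 1 g); split.
- exact: gC.
- have sd : size (drop_poly 1 g) = a.+1 by rewrite size_drop_poly sg subn1.
  split=> //.
    rewrite monicE lead_coefE sd coef_drop_poly addn1 /=.
    by move: gm; rewrite monicE lead_coefE sg.
  by move=> i ia; rewrite coef_drop_poly addn1; apply: gC.
rewrite /F; apply/polyP => i; rewrite coefD coefMX coefC.
by case: i => [|i] /=; rewrite ?add0r // coef_drop_poly addn1 addr0.
Qed.

(** The coefficient of x^(a - j) gets rho^j for j <= q and [T] for larger j, and 1 + 2 + ... + q =
    C(q+1,2). The [minn] lets the induction on [a] pass through the values below [q]. *)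
Lemma prod_staircase (R : realType) (rho T : R) (a q : nat) :
  \prod_(i < a) (if (a - i <= q)%N then rho ^+ (a - i) else T) =
  rho ^+ 'C((minn a q).+1, 2) * T ^+ (a - q).
Proof.
elim: a => [|a IH]; first by rewrite big_ord0 min0n sub0n !expr0 mulr1.
rewrite big_ord_recl subn0; under eq_bigr do rewrite lift0 subSS.
rewrite IH; case: (leqP a.+1 q) => aq.
  have -> : (a.+1 - q = 0)%N by lia.
  have -> : (a - q = 0)%N by lia.
  have -> : minn a q = a by lia.
  by rewrite !expr0 !mulr1 -exprD [in RHS]binS bin1 addnC.
have -> : minn a q = q by lia.
have -> : (a.+1 - q = (a - q).+1)%N by lia.
by rewrite exprS mulrCA.
Qed.

Lemma covered_staircase (R : realType) (C rho T : R) (a q : nat) :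
  1 <= C -> 1 <= rho -> 1 <= T -> (q <= a)%N ->
  covered (fun g : {poly int} => [/\ g \is monic, size g = a.+1 &
    forall i, (i < a)%N ->
      `|(g`_i)%R|%N%:R <= C * (if (a - i <= q)%N then rho ^+ (a - i) else T)])
    ((3 * C) ^+ a * (rho ^+ 'C(q.+1, 2) * T ^+ (a - q))).
Proof.
move=> C1 r1 T1 qa.
apply: (covered_sub _ (@covered_monic_box R a
  (fun i c => `|c|%N%:R <= C * (if (a - i <= q)%N then rho ^+ (a - i) else T))
  (fun i => 3 * (C * (if (a - i <= q)%N then rho ^+ (a - i) else T))) _)) => //.
  move=> i ia; apply: covered_int_le; apply: mulr_ege1 => //.
  by case: ifP => // _; apply: exprn_ege1.
under eq_bigr do rewrite mulrA.
by rewrite big_split /= prodr_const card_ord prod_staircase (minn_idPr qa).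
Qed.

Lemma Rcount_le (R : realType) (n k H : nat) (x : R) :
  covered (reducible_set R n k H) x -> (Rcount R n k H)%:R <= x.
Proof.
move=> [s hs sx]; apply: le_trans sx; rewrite ler_nat /Rcount.
apply: uniq_leq_size; first exact: fset_uniq.
move=> f; rewrite in_fset_set; last exact: finite_reducible_set.
by move=> /set_mem /hs.
Qed.

Lemma Rcount_ge (R : realType) (n k H : nat) (s : seq {poly int}) :
  uniq s -> (forall f, f \in s -> reducible_set R n k H f) ->
  (size s <= Rcount R n k H)%N.
Proof.
move=> us hs; apply: uniq_leq_size => // f /hs fS.
by rewrite in_fset_set ?mem_set //; exact: finite_reducible_set.
Qed.

(** * Upper bounds for reducible polynomials *)

Lemma doublebin2 (n : nat) : (2 * 'C(n.+1, 2) = n.+1 * n)%N.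
Proof. by elim: n => [|n IH] //; rewrite binS bin1 mulnDr IH; lia. Qed.

Lemma bin2D (p q : nat) : 'C(p + q, 2) = ('C(p, 2) + 'C(q, 2) + p * q)%N.
Proof.
elim: p => [|p IH]; first by rewrite add0n mul0n addn0.
by rewrite addSn !binS !bin1 IH; lia.
Qed.

Lemma factor_type_count_le (R : realType) (r : R) (a p : nat) (g : {poly int}) :
  factor_type r a p g -> (p <= a)%N.
Proof.
move=> [gm sg _ <-]; rewrite (leq_trans (count_size _ _)) //.
by have := size_zroots R gm; rewrite sg => -[->].
Qed.

Lemma factor_type_mahler_ge (R : realType) (r : R) (a p : nat) (g : {poly int}) :
  factor_type r a p g -> Num.max 1 r ^+ p <= mahler (zroots R g).
Proof. by move=> [_ _ _ <-]; apply: mahler_ge_pow. Qed.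

Lemma coef0_rootpoly (R : realType) (g : {poly int}) : g \is monic ->
  `|(g`_0)%R|%N%:R = \prod_(z <- zroots R g) nc z.
Proof.
move=> gm; rewrite -normc_coef_intpoly intpolyE // -horner_coef0 /rootpoly.
rewrite horner_prod normc_prod; apply: eq_bigr => z _.
by rewrite !hornerE normc_opp.
Qed.

Lemma coef0_equimodular (R : realType) (r : R) (a : nat) (g : {poly int}) :
  factor_type r a a g -> `|(g`_0)%R|%N%:R = r ^+ a.
Proof.
move=> [gm sg hr cr]; rewrite (coef0_rootpoly R gm).
have szr : size (zroots R g) = a.
  by have := size_zroots R gm; rewrite sg => -[->].
have : all (fun z => nc z == r) (zroots R g) by rewrite all_count cr szr.
rewrite -szr; elim: (zroots R g) => [|z s IH]; first by rewrite big_nil.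
by rewrite big_cons /= => /andP[/eqP-> /IH->]; rewrite exprS.
Qed.

Lemma factor_type_ge0 (R : realType) (r : R) (a p : nat) (g : {poly int}) :
  factor_type r a p g -> (0 < p)%N -> 0 <= r.
Proof.
by move=> [_ _ _ <-]; rewrite -has_count => /hasP[z _ /eqP <-]; apply: normc_ge0.
Qed.

(** The basic count of the upper bounds. It is applied with [p] the number of roots of maximal
    modulus: then rho^p is at most of the order of [T], so that rho^j is the better bound for j <=
    p. *)
Lemma covered_factor (R : realType) (a p : nat) (rho T : R) :
  1 <= rho -> 1 <= T -> (p <= a)%N ->
  covered (fun g => [/\ g \is monic, size g = a.+1,
     forall z, z \in zroots R g -> nc z <= rho & mahler (zroots R g) <= T])
    ((3 * 2 ^+ a) ^+ a * (rho ^+ 'C(p.+1, 2) * T ^+ (a - p))).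
Proof.
move=> r1 T1 pa.
apply: (covered_sub _ (covered_staircase (C := 2 ^+ a) _ r1 T1 pa)) => //; last first.
  by apply: exprn_ege1; lra.
move=> g [gm sg hr hM]; split=> // i ia.
case: ifP => _.
  by apply: abscoef_le_pow => //; apply: le_trans r1.
by apply: le_trans (abscoef_le_mahler R i gm sg) _; rewrite ler_wpM2l ?exprn_ge0.
Qed.

(** * Products of two factors that both have roots of maximal modulus *)

Definition split_type (R : realType) (a b p q : nat) (X : R) (f : {poly int}) :=
  exists (g h : {poly int}) (r : R), [/\ f = g * h, factor_type r a p g,
    factor_type r b q h & mahler (zroots R g) * mahler (zroots R h) <= X].

Lemma split_typeC (R : realType) (a b p q : nat) (X : R) (f : {poly int}) :
  split_type a b p q X f -> split_type b a q p X f.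
Proof.
by move=> [g [h [r [-> gf hf M]]]]; exists h, g, r; split; rewrite // mulrC.
Qed.

Lemma max1_factor_type (R : realType) (r : R) (a p : nat) (g : {poly int}) :
  factor_type r a p g -> forall z, z \in zroots R g -> nc z <= Num.max 1 r.
Proof. by move=> [_ _ h _] z /h zr; rewrite le_max zr orbT. Qed.

Lemma max1_powr_le (R : realType) (a b p q : nat) (y r : R) (g h : {poly int}) :
  1 <= y -> (0 < p + q)%N ->
  factor_type r a p g -> factor_type r b q h ->
  mahler (zroots R g) * mahler (zroots R h) <= y ^+ (p + q) -> Num.max 1 r <= y.
Proof.
move=> y1 pq gf hf M.
rewrite -(@ler_pXn2r R (p + q)%N) // ?nnegrE ?le_max ?ler01 //; last first.
  by apply: le_trans y1.
apply: le_trans M; rewrite exprD.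
by apply: ler_pM; rewrite ?exprn_ge0 ?le_max ?ler01 ?factor_type_mahler_ge //;
  apply: factor_type_mahler_ge; eassumption.
Qed.

(* Both factors have all their roots of modulus [r]; the integer [N = |g(0)|]
   determines [r], and hence the constant terms up to sign. *)
Lemma covered_equimodular (R : realType) (a b : nat) :
  (0 < a)%N -> (0 < b)%N ->
  exists2 C : R, 0 <= C & forall y : R, 1 <= y ->
    covered (split_type a b a b (y ^+ (a + b))) (C * y ^+ 'C(a + b, 2)).
Proof.
case: a b => [//|a] [//|b] _ _.
set n := (a.+1 + b.+1)%N.
pose D c : R := 2 * (3 * 2 ^+ c.+1) ^+ c.
have D0 c : 0 <= D c by rewrite mulr_ge0 // exprn_ge0 // mulr_ge0 // exprn_ge0.
exists (2 * (D a * D b)); first by rewrite !mulr_ge0.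
move=> y y1; have y0 : 0 <= y by apply: le_trans y1.
(* Once [r] is fixed, the constant term has two values, and the other [c] coefficients are bounded
   by constant multiples of y, y^2, ..., y^c. *)
have boxc c (r : R) : 0 <= r <= y -> covered (fun g => factor_type r c.+1 c.+1 g)
    (D c * y ^+ 'C(c.+1, 2)).
  move=> /andP[r0 ry].
  pose Cs i (x : int) := if i is 0%N then `|x|%N%:R = r ^+ c.+1
     else `|x|%N%:R <= 2 ^+ c.+1 * y ^+ (c.+1 - i).
  pose xs i : R := if i is 0%N then 2 else 3 * (2 ^+ c.+1 * y ^+ (c.+1 - i)).
  apply: (covered_sub _ (@covered_monic_box R c.+1 Cs xs _)).
  - move=> g [gm sg hr cr]; split=> // -[|i] ic /=.
      exact: coef0_equimodular.
    apply: (le_trans (abscoef_le_pow (rho := r) i.+1 gm sg r0 hr)).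
    by rewrite ler_wpM2l ?exprn_ge0 // lerXn2r ?nnegrE.
  - case=> [|i] ic; first exact: covered_int_abs.
    apply: covered_int_le; apply: mulr_ege1; apply: exprn_ege1 => //; lra.
  - rewrite big_ord_recl /= -mulrA ler_wpM2l //.
    under eq_bigr do rewrite mulrA subSS.
    rewrite big_split /= prodr_const card_ord ler_wpM2l //.
    have := prod_staircase y 1 c c; rewrite minnn expr1n mulr1 => <-.
    by under [leRHS]eq_bigr do rewrite leq_subr.
apply: (@covered_sub _ _ _ (fun f => exists2 N : nat, N%:R <= y ^+ a.+1 &
   exists g h (r : R), [/\ f = g * h, r ^+ a.+1 = N%:R, 0 <= r <= y, factor_type r a.+1 a.+1 g
     & factor_type r b.+1 b.+1 h]) (2 * y ^+ a.+1 *
     ((D a * y ^+ 'C(a.+1, 2)) * (D b * y ^+ 'C(b.+1, 2))))).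
- move=> f [g [h [r [fE gf hf M]]]].
  have ry : Num.max 1 r <= y by apply: (max1_powr_le _ _ gf hf M).
  have {}ry : r <= y by apply: le_trans ry; rewrite le_max lexx orbT.
  have r0 : 0 <= r by apply: factor_type_ge0 gf _.
  have NE := coef0_equimodular gf.
  exists `|(g`_0)%R|%N; first by rewrite NE lerXn2r ?nnegrE.
  by exists g, h, r; rewrite NE r0 ry.
- apply: covered_bind.
  + by rewrite !mulr_ge0 ?exprn_ge0.
  + exists (iota 0 (Num.truncn (y ^+ a.+1)).+1).
      by move=> N Ny; rewrite mem_iota /= add0n ltnS truncn_ge_nat ?exprn_ge0.
    rewrite size_iota -natr1.
    have : (Num.truncn (y ^+ a.+1))%:R <= y ^+ a.+1 by rewrite truncn_le exprn_ge0.
    have : 1 <= y ^+ a.+1 by apply: exprn_ege1.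
    by move=> *; lra.
  (* [r] is taken from one element of the cell; all the others share it, since its power of exponent
     [a.+1] is [N]. *)
  + move=> N _; apply: covered_nonempty; first by rewrite !mulr_ge0 ?exprn_ge0.
    move=> [_ [_ [_ [r [_ rN ry _ _]]]]].
    apply: (covered_sub _ (covered_image2 *%R (boxc a r ry) (boxc b r ry))) => //.
    move=> f [g [h [r' [fE r'N r'y gf hf]]]]; exists g, h.
    have <- : r' = r.
      apply: (@pexpIrn _ a.+1) => //; rewrite ?nnegrE ?r'N //.
      - by case/andP: r'y.
      - by case/andP: ry.
    by [].
have -> : 2 * y ^+ a.+1 * ((D a * y ^+ 'C(a.+1, 2)) * (D b * y ^+ 'C(b.+1, 2)))
   = 2 * (D a * D b) * y ^+ (a.+1 + 'C(a.+1, 2) + 'C(b.+1, 2)).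
  by rewrite !exprD; ring.
(* By [bin2D] the target exponent contains the product of the two degrees, which pays for the
   exponent [a.+1] of the choices of [N]. *)
rewrite ler_wpM2l ?mulr_ge0 // ler_weXn2l // /n bin2D; nia.
Qed.

(* [k (a + b) - 'C(k + 1, 2)] is [k] times the exponent in the theorem: [y] is
   the [k]-th root of the bound for the height. *)
Lemma covered_mixed_linear (R : realType) (b q : nat) :
  (0 < q)%N -> (q < b)%N ->
  exists2 C : R, 0 <= C & forall y : R, 1 <= y ->
    covered (split_type 1 b 1 q (y ^+ q.+1))
      (C * y ^+ (q.+1 * b.+1 - 'C(q.+2, 2))).
Proof.
move=> q0 qb; pose D : R := (3 * 2 ^+ b) ^+ b.
have D0 : 0 <= D by rewrite exprn_ge0 // mulr_ge0 ?exprn_ge0.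
exists (3 * D); first by rewrite mulr_ge0.
move=> y y1; have y0 : 0 <= y by apply: le_trans y1.
(* For a given [c], the number of [h] is at most a constant times t^C(q+1,2) (y^k / t)^(b-q). As q <
   b, one power of t cancels; then t <= y and y^k / t <= y^k leave y^e. The 3 y values of [c] supply
   the missing power of y. *)
pose k := q.+1; set e := ('C(q.+1, 2).-1 + k * (b - q))%N.
apply: (@covered_sub _ _ _ (fun f => exists2 c : int, `|c|%N%:R <= y &
   exists g h, [/\ g = 'X - c%:P, let t : R := Num.max 1 `|c|%N%:R in [/\ h \is monic, size h = b.+1,
     forall z, z \in zroots R h -> nc z <= t & mahler (zroots R h) <= y ^+ k / t] & f = g * h])
   (3 * y * (D * y ^+ e))).
- move=> f [g [h [r [fE gf hf M]]]].
  have ry : Num.max 1 r <= y by apply: (max1_powr_le _ _ gf hf M).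
  have cr := coef0_equimodular gf; rewrite expr1 in cr.
  have [gm sg _ _] := gf; have [hm sh _ _] := hf.
  exists (- g`_0); first by rewrite abszN cr (le_trans _ ry) // le_max lexx orbT.
  exists g, h; rewrite abszN cr /=; split=> //.
    apply/polyP => i; rewrite coefB coefX coefC; case: i => [|[|i]] /=.
    - by rewrite sub0r opprK.
    - by rewrite subr0; have := monicP gm; rewrite lead_coefE sg.
    - by rewrite subr0 nth_default // sg.
  split=> //; first exact: max1_factor_type hf.
  rewrite ler_pdivlMr ?lt_max ?ltr01 //; apply: le_trans M.
  rewrite mulrC; apply: ler_wpM2r; first exact: ltW (mahler_gt0 _).
  by have := factor_type_mahler_ge gf; rewrite expr1.
- apply: covered_bind; first by rewrite mulr_ge0 ?exprn_ge0.
    exact: covered_int_le.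
  move=> c cy; set t : R := Num.max 1 `|c|%N%:R.
  have t1 : 1 <= t by rewrite le_max lexx.
  have t0 : 0 < t by apply: lt_le_trans t1.
  have ty : t <= y by rewrite ge_max y1 cy.
  have u1 : 1 <= y ^+ k / t.
    rewrite ler_pdivlMr // mul1r (le_trans ty) // /k exprS ler_peMr //.
    exact: exprn_ege1.
  have [s hs sx] := covered_factor t1 u1 (ltnW qb).
  exists [seq ('X - c%:P) * h | h <- s].
    by move=> f [g [h [-> hh ->]]]; apply/map_f/hs.
  rewrite size_map; apply: (le_trans sx); rewrite ler_wpM2l // /e.
  have -> : 'C(q.+1, 2) = 'C(q.+1, 2).-1.+1.
    by rewrite prednK //; have := doublebin2 q; nia.
  have -> : (b - q = (b - q).-1.+1)%N by lia.
  set m := 'C(_, 2).-1; rewrite [t ^+ m.+1]exprSr [(_ / t) ^+ _.+1]exprS.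
  rewrite mulrA -[X in X * _]mulrA [t * _]mulrC divfK ?gt_eqF //.
  rewrite exprD exprM [in leRHS]exprS -mulrA; apply: ler_pM.
  - by rewrite exprn_ge0 // ltW.
  - by rewrite mulr_ge0 // ?exprn_ge0 // (le_trans _ u1).
  - by rewrite lerXn2r // nnegrE ltW.
  rewrite ler_wpM2l ?exprn_ge0 // lerXn2r ?nnegrE ?exprn_ge0 // ?(le_trans _ u1) //.
  by rewrite ler_pdivrMr // ler_peMr // exprn_ge0.
- rewrite mulrACA -exprS ler_wpM2l ?mulr_ge0 // ler_weXn2l // /e /k.
  have c2 := doublebin2 q; have c0 : (0 < 'C(q.+1, 2))%N by rewrite bin_gt0.
  rewrite [in X in (_ <= X)%N]binS bin1 mulnBr mulnS.
  have := leq_mul (leqnn q.+1) (ltnW qb); lia.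
Qed.

Lemma ln_le_id (R : realType) (x : R) : 0 < x -> ln x <= x.
Proof.
move=> x0; have := @le_ln1Dx R (x - 1); have -> : 1 + (x - 1) = x by ring.
move=> h.
by apply: le_trans (h _) _; lra.
Qed.

(* Dyadic cells up to [y ^ k] are cheap: there are [O(sqrt y)] of them. *)
Lemma dyadic_count (R : realType) (k : nat) :
  exists2 C : R, 0 <= C & forall y : R, 1 <= y ->
    exists2 L : nat, (L%:R ^+ 2 <= C * y) &
      forall i : nat, 2 ^+ i <= y ^+ k -> (i < L)%N.
Proof.
have l2 : 0 < ln (2 : R) by rewrite ln_gt0 // ltr1n.
(* The constant comes from i ln 2 <= k ln y = 2 k ln (sqrt y) <= 2 k sqrt y. *)
pose D : R := 2 * k%:R / ln 2 + 1.
have D1 : 1 <= D by rewrite /D lerDr divr_ge0 ?mulr_ge0 // ltW.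
exists (D ^+ 2) => [|y y1]; first by rewrite sqr_ge0.
have y0 : 0 <= y by apply: le_trans y1.
pose w := Num.sqrt y.
have w2 : w ^+ 2 = y by rewrite sqr_sqrtr.
have w1 : 1 <= w by rewrite -sqrtr1 ler_sqrt // (lt_le_trans ltr01).
have w0 : 0 < w by apply: lt_le_trans w1.
have e0 : 0 <= 2 * k%:R / ln 2 * w.
  by rewrite !mulr_ge0 ?invr_ge0 // ltW.
exists (Num.truncn (2 * k%:R / ln 2 * w)).+1.
  have Lw : (Num.truncn (2 * k%:R / ln 2 * w)).+1%:R <= D * w.
    by rewrite /D [leRHS]mulrDl mul1r -[X in X <= _]natr1 lerD // truncn_le.
  by rewrite -w2 -exprMn lerXn2r ?nnegrE ?(le_trans _ Lw).
move=> i hi; rewrite ltnS truncn_ge_nat //.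
have p0 : 0 < (2 : R) ^+ i by rewrite exprn_gt0.
have : ln ((2 : R) ^+ i) <= ln (y ^+ k).
  by rewrite ler_ln ?posrE // exprn_gt0 // (lt_le_trans ltr01).
rewrite -w2 -exprM !lnXn ?ltr0n // => h.
have -> : 2 * k%:R / ln 2 * w = (2 * k)%:R * w / ln 2 by rewrite natrM; ring.
rewrite ler_pdivlMr // [leLHS]mulr_natl; apply: (le_trans h).
by rewrite -[leLHS]mulr_natl ler_wpM2l ?ln_le_id.
Qed.

Lemma dyadic_floor (R : realType) (x : R) : 1 <= x ->
  exists i : nat, 2 ^+ i <= x < 2 ^+ i.+1.
Proof.
move=> x1; have x0 : 0 <= x by apply: le_trans x1.
have m1 : (0 < Num.truncn x)%N by rewrite truncn_gt0.
have /andP[h1 h2] := trunc_log_bounds (isT : 1 < 2)%N m1.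
exists (trunc_log 2 (Num.truncn x)); apply/andP; split.
  by rewrite -natrX -truncn_ge_nat.
by rewrite -natrX -truncn_lt_nat.
Qed.

(** [A] and [B] count the roots of smaller modulus in the two factors. By [bin2D] the claim is p + q
    < p q + q A + p B, and the strictness is the power of y that pays for the dyadic cells. It fails
    for p = 1, A = 0, B = 1 (a linear factor) and for p = q = 2, A = B = 0 (all roots of equal
    modulus), which is why these two cases are treated apart. *)
Lemma mixed_exponent (p q A B : nat) :
  (0 < p)%N -> (0 < q)%N -> (1 < p + A)%N -> (1 < q + B)%N -> (0 < A + B)%N ->
  ('C(p.+1, 2) + 'C(q.+1, 2) <= 'C(p + q, 2).-1 + (q * A + p * B))%N.
Proof.
move=> p0 q0 pA qB AB; rewrite bin2D !binS !bin1.
have pq0 : (0 < p * q)%N by rewrite muln_gt0 p0.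
suff : (p + q < p * q + q * A + p * B)%N by lia.
have [A0|A0] := posnP A.
  subst A; have B0 : (0 < B)%N by lia.
  have h1 := leq_mul (leqnn p) B0.
  have : (2 * q <= p * q)%N by rewrite leq_mul2r; lia.
  lia.
have [B0|B0] := posnP B.
  subst B; have h1 := leq_mul (leqnn q) A0.
  have : (p * 2 <= p * q)%N by rewrite leq_mul2l; lia.
  lia.
have h1 := leq_mul (leqnn q) A0; have h2 := leq_mul (leqnn p) B0; lia.
Qed.

(** Splits one power of y off the target exponent; what remains is the exponent of a single cell in
    [dyadic_cell_bound]. *)
Lemma height_exponent (a b p q : nat) :
  (p <= a)%N -> (q <= b)%N -> (1 < p + q)%N ->
  ((p + q) * (a + b) - 'C((p + q).+1, 2) =
     ('C(p + q, 2).-1 + (p + q) * (a - p + (b - q))).+1)%N.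
Proof.
move=> pa qb pq; have c0 : (0 < 'C(p + q, 2))%N by rewrite bin_gt0.
rewrite -[in RHS]addSn prednK // binS bin1.
have -> : (a + b = (a - p + (b - q)) + (p + q))%N by lia.
have c2 := doublebin2 (p + q); rewrite binS bin1 in c2.
move: (p + q)%N (a - p + (b - q))%N c2 => k d c2.
rewrite mulnDr; lia.
Qed.

(** [s] stands for the radius, [T] and [U] for the bounds on the Mahler measures of the two factors.
    From s^p <= T and s^q <= U both T s^q and U s^p are at most T U. Replacing T^A U^B accordingly
    removes q A + p B powers of s; by [mixed_exponent] at most C(p+q,2) - 1 of them remain, and s <=
    y. *)
Lemma dyadic_cell_bound (R : realType) (p q A B : nat) (y s T U : R) :
  (0 < p)%N -> (0 < q)%N -> (1 < p + A)%N -> (1 < q + B)%N -> (0 < A + B)%N ->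
  1 <= y -> 1 <= s -> s <= y -> 0 < T -> 0 < U -> s ^+ p <= T -> s ^+ q <= U ->
  T * U = 2 * y ^+ (p + q) ->
  s ^+ 'C(p.+1, 2) * T ^+ A * (s ^+ 'C(q.+1, 2) * U ^+ B) <=
    2 ^+ (A + B) * y ^+ ('C(p + q, 2).-1 + (p + q) * (A + B)).
Proof.
move=> p0 q0 pA qB AB y1 s1 sy T0 U0 sT sU TU.
have y0 : 0 < y by apply: lt_le_trans y1.
have s0 : 0 < s by apply: lt_le_trans s1.
have Z0 : 0 < 2 * y ^+ (p + q) by rewrite mulr_gt0 ?exprn_gt0.
have hT : T * s ^+ q <= 2 * y ^+ (p + q) by rewrite -TU ler_pM2l.
have hU : U * s ^+ p <= 2 * y ^+ (p + q) by rewrite -TU mulrC ler_pM2r.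
have hTU : T ^+ A * U ^+ B * s ^+ (q * A + p * B) <= 2 ^+ (A + B) * y ^+ ((p + q) * (A + B)).
  have -> : T ^+ A * U ^+ B * s ^+ (q * A + p * B) = (T * s ^+ q) ^+ A * (U * s ^+ p) ^+ B.
    by rewrite !exprMn -!exprM exprD; ring.
  rewrite [y ^+ _]exprM -exprMn [leRHS]exprD.
  have T0' := ltW T0; have U0' := ltW U0; have s0' := ltW s0; have Z0' := ltW Z0.
  by apply: ler_pM; rewrite ?exprn_ge0 ?lerXn2r ?nnegrE ?mulr_ge0 ?exprn_ge0 ?(ltW y0).
have expo := mixed_exponent p0 q0 pA qB AB.
rewrite mulrACA -exprD [y ^+ _]exprD [leRHS]mulrCA.
apply: (@le_trans _ _ (s ^+ ('C(p + q, 2).-1 + (q * A + p * B)) * (T ^+ A * U ^+ B))).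
  rewrite ler_wpM2r ?mulr_ge0 ?exprn_ge0 ?(ltW T0) ?(ltW U0) //.
  by rewrite ler_weXn2l.
rewrite exprD -mulrA; apply: ler_pM; rewrite ?mulr_ge0 ?exprn_ge0 ?(ltW T0) ?(ltW U0) ?(ltW s0) //.
  by rewrite lerXn2r // nnegrE ltW.
by rewrite mulrC.
Qed.

Lemma covered_mixed_dyadic (R : realType) (a b p q : nat) :
  (0 < p)%N -> (0 < q)%N -> (1 < a)%N -> (1 < b)%N -> (p <= a)%N -> (q <= b)%N ->
  (p + q < a + b)%N ->
  exists2 C : R, 0 <= C & forall y : R, 1 <= y ->
    covered (split_type a b p q (y ^+ (p + q)))
      (C * y ^+ ((p + q) * (a + b) - 'C((p + q).+1, 2))).
Proof.
move=> p0 q0 a1 b1 pa qb pqab.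
have pq1 : (1 < p + q)%N by lia.
have pq0 : (0 < p + q)%N by lia.
pose k := (p + q)%N; pose D c : R := (3 * 2 ^+ c) ^+ c.
have D0 c : 0 <= D c by rewrite exprn_ge0 // mulr_ge0 ?exprn_ge0.
have [CL CL0 dyad] := dyadic_count R k.
pose A := (a - p)%N; pose B := (b - q)%N.
have pA : (1 < p + A)%N by rewrite subnKC.
have qB : (1 < q + B)%N by rewrite subnKC.
have AB0 : (0 < A + B)%N by rewrite /A /B; lia.
pose E : R := (D a * 2 ^+ 'C(p.+1, 2)) * (D b * 2 ^+ 'C(q.+1, 2)) * 2 ^+ (A + B).
have E0 : 0 <= E by rewrite !mulr_ge0 ?exprn_ge0.
exists (CL * E); first by rewrite mulr_ge0.
move=> y y1; have y0 : 0 < y by apply: lt_le_trans y1.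
have [L hL hi] := dyad y y1.
pose e := ('C(p + q, 2).-1 + (p + q) * (A + B))%N.
have yk0 : 0 < y ^+ k by rewrite exprn_gt0.
apply: (@covered_sub _ _ _ (fun f => exists2 ij : nat * nat, (ij.1 < L)%N /\ (ij.2 < L)%N &
   exists g h r, [/\ f = g * h, factor_type r a p g /\ factor_type r b q h,
     2 ^+ ij.1 <= Num.max 1 r < 2 ^+ ij.1.+1 /\ 2 ^+ ij.2 <= mahler (zroots R g) < 2 ^+ ij.2.+1 &
      mahler (zroots R g) * mahler (zroots R h) <= y ^+ k])
   (L%:R ^+ 2 * (E * y ^+ e))).
- move=> f [g [h [r [fE gf hf M]]]].
  have ry : Num.max 1 r <= y by apply: (max1_powr_le _ _ gf hf M).
  have [i ir] : exists i : nat, 2 ^+ i <= Num.max 1 r < 2 ^+ i.+1.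
    by apply: dyadic_floor; rewrite le_max lexx.
  have [j jg] := dyadic_floor (mahler_ge1 (zroots R g)).
  exists (i, j); last by exists g, h, r.
  split; apply: hi.
    case/andP: ir => ir _; apply: (le_trans ir); apply: (le_trans ry).
    by rewrite ler_eXnr // addn_gt0 p0.
  case/andP: jg => jg _; apply: (le_trans jg); apply: le_trans M.
  by rewrite ler_peMr ?mahler_ge1 // ltW ?mahler_gt0.
- apply: covered_bind.
  + by rewrite mulr_ge0 ?exprn_ge0 // ltW.
  + exists [seq (i, j) | i <- iota 0 L, j <- iota 0 L].
      by move=> [i j] [/= iL jL]; apply/allpairsP; exists (i, j); rewrite !mem_iota.
    by rewrite size_allpairs size_iota natrM expr2.
  move=> [i j] _; apply: covered_nonempty; first by rewrite mulr_ge0 ?exprn_ge0 // ltW.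
  move=> [_ [g [h [r [_ [gf hf] [/= /andP[ir _] /andP[jg jg']] M]]]]].
  have ry : Num.max 1 r <= y by apply: (max1_powr_le _ _ gf hf M).
  (* In this cell M(g) lies between T / 2 and T, so that M(h) is at most [U]. The element at hand
     yields s^p <= T and s^q <= U, which only involve the parameters of the cell. *)
  set s : R := 2 ^+ i; set T : R := 2 ^+ j.+1; set U : R := 2 * y ^+ k / T.
  have s1 : 1 <= s by apply: exprn_ege1; rewrite ler1n.
  have T1 : 1 <= T by apply: exprn_ege1; rewrite ler1n.
  have T0 : 0 < T by apply: lt_le_trans T1.
  have s0 : 0 < s by apply: lt_le_trans s1.
  have hU h' g' : 2 ^+ j <= mahler (zroots R g') ->
      mahler (zroots R g') * mahler (zroots R h') <= y ^+ k -> mahler (zroots R h') <= U.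
    move=> jg0 M0; rewrite /U ler_pdivlMr // /T exprS mulrCA ler_pM2l //.
    apply: le_trans M0; rewrite mulrC; apply: ler_wpM2r => //.
    exact: ltW (mahler_gt0 _).
  have U1 : 1 <= U by apply: le_trans (hU _ _ jg M); apply: mahler_ge1.
  have sT : s ^+ p <= T.
    apply: (le_trans _ (ltW jg')); apply: le_trans (factor_type_mahler_ge gf).
    by rewrite lerXn2r ?nnegrE ?(ltW s0) // le_max ler01.
  have sU : s ^+ q <= U.
    apply: (le_trans _ (hU _ _ jg M)); apply: le_trans (factor_type_mahler_ge hf).
    by rewrite lerXn2r ?nnegrE ?(ltW s0) // le_max ler01.
  have s21 : 1 <= 2 * s by rewrite mulr_ege1 // ler1n.
  have cov := covered_image2 *%R (covered_factor s21 T1 pa) (covered_factor s21 U1 qb).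
  apply: (covered_sub _ cov).
    move=> f [g' [h' [r' [fE [gf' hf'] [/andP[_ ir'] /andP[jg0 jg1]] M']]]].
    have rs : Num.max 1 r' <= 2 * s by rewrite -exprS ltW.
    have [gm sg _ _] := gf'; have [hm sh _ _] := hf'.
    exists g', h'; split=> //; split=> //.
    - by move=> z zg; apply: le_trans rs; apply: (max1_factor_type gf').
    - exact: ltW.
    - by move=> z zg; apply: le_trans rs; apply: (max1_factor_type hf').
    - exact: hU jg0 M'.
  have TU : T * U = 2 * y ^+ (p + q) by rewrite /U mulrC divfK ?gt_eqF.
  have := @dyadic_cell_bound R p q A B y s T U p0 q0.
  move=> /(_ _ _ _ y1 s1 (le_trans ir ry) T0 (lt_le_trans ltr01 U1) sT sU TU) h1.
  rewrite [(2 * s) ^+ 'C(p.+1, 2)]exprMn [(2 * s) ^+ 'C(q.+1, 2)]exprMn -/(D a) -/(D b) -/A -/B.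
  have -> : D a * (2 ^+ 'C(p.+1, 2) * s ^+ 'C(p.+1, 2) * T ^+ A) *
      (D b * (2 ^+ 'C(q.+1, 2) * s ^+ 'C(q.+1, 2) * U ^+ B)) =
    (D a * 2 ^+ 'C(p.+1, 2)) * (D b * 2 ^+ 'C(q.+1, 2)) * 
      (s ^+ 'C(p.+1, 2) * T ^+ A * (s ^+ 'C(q.+1, 2) * U ^+ B)) by ring.
  rewrite /E -[leRHS]mulrA ler_wpM2l ?mulr_ge0 ?exprn_ge0 //.
  by apply: h1.
have -> : CL * E * y ^+ ((p + q) * (a + b) - 'C((p + q).+1, 2)) = CL * y * (E * y ^+ e).
  rewrite height_exponent //.
  by rewrite exprS; ring.
by rewrite ler_wpM2r // mulr_ge0 ?exprn_ge0 // ltW.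
Qed.

(** * Products with all the roots of maximal modulus in one factor *)

Lemma sum_inv_3half (R : realType) (m : nat) :
  \sum_(j < m) (j.+1%:R * Num.sqrt j.+1%:R)^-1 <= 4 - 4 / Num.sqrt m.+1%:R :> R.
Proof.
elim: m => [|m IH]; first by rewrite big_ord0 sqrtr1; lra.
rewrite big_ord_recr /=; move: IH; set S := \sum_(_ < _) _ => IH.
set u : R := Num.sqrt m.+1%:R in IH *; set v : R := Num.sqrt m.+2%:R.
have u2 : u ^+ 2 = m.+1%:R by rewrite sqr_sqrtr.
have v2 : v ^+ 2 = u ^+ 2 + 1 by rewrite u2 natr1 sqr_sqrtr.
have u1 : 1 <= u by rewrite -sqrtr1 ler_sqrt ?ltr0n // ler1n.
have v0 : 0 <= v by rewrite sqrtr_ge0.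
have u0 : 0 < u by lra.
have uv : u < v by nra.
have vu : v <= 2 * u by nra.
(* The right-hand side is 4 / (u v (u + v)), and v (u + v) = v^2 + u v <= 4 u^2, because v^2 = u^2 +
   1 <= 2 u^2 and v <= 2 u. *)
have step : (u ^+ 2 * u)^-1 <= 4 / u - 4 / v.
  have -> : 4 / u - 4 / v = 4 * (u ^+ 2 / (v * (u + v))) * (u ^+ 2 * u)^-1.
    have vv : v - u = (u + v)^-1.
      apply: (mulIf (x := u + v)); first by rewrite gt_eqF //; lra.
      by rewrite mulVf ?gt_eqF //; [nra|lra].
    have -> : 4 / u - 4 / v = 4 * (v - u) / (u * v).
      by field; rewrite !gt_eqF //; lra.
    rewrite vv; field; rewrite !gt_eqF //; lra.
  rewrite ler_peMl ?invr_ge0 ?mulr_ge0 ?sqr_ge0 ?(ltW u0) // mulrA.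
  rewrite ler_pdivlMr ?mul1r ?mulr_gt0 //; [nra|lra|lra].
by rewrite -u2; lra.
Qed.

(* [c] is a coefficient of [g] of largest absolute value. *)
Definition outer_cell (R : realType) (a b : nat) (rho T : R) (i : nat) (c : int)
    (f : {poly int}) :=
  exists g h : {poly int}, [/\
    [/\ g \is monic, size g = a.+1 & forall j, (j < a)%N ->
      if j == i then g`_j = c else `|(g`_j)%R|%N%:R <= Num.max 1 `|c|%N%:R :> R],
    [/\ h \is monic, size h = b.+1, forall z, z \in zroots R h -> nc z <= rho &
       mahler (zroots R h) <= T] & f = g * h].

Lemma covered_outer_cell (R : realType) (a b k i : nat) (c : int) (rho T : R) :
  (i < a)%N -> 1 <= rho -> 1 <= T -> (k <= b)%N ->
  covered (outer_cell a b rho T i c)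
    ((3 * Num.max 1 `|c|%N%:R) ^+ a.-1 *
      ((3 * 2 ^+ b) ^+ b * (rho ^+ 'C(k.+1, 2) * T ^+ (b - k)))).
Proof.
move=> ia r1 T1 kb; set t : R := Num.max 1 _.
have t1 : 1 <= t by rewrite le_max lexx.
pose C (j : nat) (x : int) := if j == i then x = c else `|x|%N%:R <= t.
have covC (j : nat) : (j < a)%N -> covered (C j) (if j == i then 1 else 3 * t).
  move=> _; rewrite /C; case: eqP => _; last exact: covered_int_le.
  by exists [:: c] => // x ->; rewrite mem_head.
have prodE : \prod_(j < a) (if nat_of_ord j == i then 1 else 3 * t) = (3 * t) ^+ a.-1.
  rewrite (bigD1 (Ordinal ia)) //= eqxx mul1r.
  under eq_bigr => j /negPf ji do rewrite -[nat_of_ord j == i]/(j == Ordinal ia) ji.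
  by rewrite prodr_const cardC1 card_ord.
rewrite -prodE.
apply: (covered_sub _ (covered_image2 *%R (covered_monic_box covC)
  (covered_factor r1 T1 kb))) => //.
Qed.

(** Large coefficients of [g] force small roots of [h]. With t = max(1, |c|), M(g) is at least t /
    2^a, so M(h) is at most the value of rho^k fixed by the equation; and max(1, r)^k <= M(h)
    because all the [k] roots of modulus [r] belong to [h]. *)
Lemma split_type_outer (R : realType) (a b k : nat) (y : R) (f : {poly int}) :
  (0 < a)%N -> (0 < k)%N -> 0 <= y -> split_type a b 0 k (y ^+ k) f ->
  exists (i : nat) (c : int), [/\ (i < a)%N, Num.max 1 `|c|%N%:R <= (2 ^+ a * y) ^+ k &
    forall rho : R, 0 <= rho -> Num.max 1 `|c|%N%:R * rho ^+ k = (2 ^+ a * y) ^+ k ->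
    outer_cell a b rho (rho ^+ k) i c f].
Proof.
case: a => [//|a] _ k0 y0 [g [h [r [fE gf hf M]]]].
have [gm sg _ _] := gf; have [hm sh hr _] := hf.
have [i _ imax] := arg_maxnP (fun j : 'I_a.+1 => `|(g`_j)%R|%N) (isT : predT ord0).
set t : R := Num.max 1 `|(g`_i)%R|%N%:R.
have t0 : 0 < t by rewrite lt_max ltr01.
have tM : t <= 2 ^+ a.+1 * mahler (zroots R g).
  rewrite ge_max (abscoef_le_mahler R i gm sg) andbT mulr_ege1 ?mahler_ge1 //.
  by apply: exprn_ege1; rewrite ler1n.
have thM : t * mahler (zroots R h) <= (2 ^+ a.+1 * y) ^+ k.
  apply: (@le_trans _ _ (2 ^+ a.+1 * y ^+ k)).
    apply: (@le_trans _ _ (2 ^+ a.+1 * mahler (zroots R g) * mahler (zroots R h))).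
      by apply: ler_wpM2r => //; apply: ltW; apply: mahler_gt0.
    by rewrite -mulrA ler_wpM2l ?exprn_ge0.
  rewrite exprMn ler_wpM2r ?exprn_ge0 //.
  by rewrite ler_eXnr // exprn_ege1 // ler1n.
exists i, g`_i; rewrite -/t; split=> //.
  by apply: le_trans thM; rewrite ler_peMr ?mahler_ge1 // ltW.
move=> rho rho0 rhoE; have Mh : mahler (zroots R h) <= rho ^+ k.
  by rewrite -(ler_pM2l t0) rhoE.
exists g, h; split=> //; split=> //.
  move=> j ja; case: eqP => [->//|_]; rewrite -/t /t le_max ler_nat.
  by have := imax (Ordinal ja) isT; rewrite /= => ->; rewrite orbT.
move=> z /hr zr; apply: (le_trans zr); apply: (@le_trans _ _ (Num.max 1 r)).
  by rewrite le_max lexx orbT.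
rewrite -(@ler_pXn2r R k) // ?nnegrE ?le_max ?ler01 //.
by apply: le_trans Mh; apply: factor_type_mahler_ge hf.
Qed.

Lemma outer_radius (R : realType) (k : nat) (y t : R) :
  (0 < k)%N -> 0 <= y -> 1 <= t -> t <= y ^+ k ->
  exists rho s : R, [/\ 1 <= rho, t * rho ^+ k = y ^+ k, rho = y * s, 0 <= s <= 1 & s ^+ k = t^-1].
Proof.
move=> k0 y0 t1 ty; have t0 : 0 < t by apply: lt_le_trans t1.
pose s := t `^ (- k%:R^-1); exists (y * s), s.
have s0 : 0 <= s by apply: powR_ge0.
have sk : s ^+ k = t^-1.
  rewrite -powR_mulrn // /s -powRrM mulNr mulVf ?powR_inv1 ?(ltW t0) //.
  by rewrite pnatr_eq0 -lt0n.
have tk : t * (y * s) ^+ k = y ^+ k by rewrite exprMn sk mulrCA mulfV ?gt_eqF // mulr1.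
split=> //.
  rewrite -(@ler_pXn2r R k) // ?nnegrE ?mulr_ge0 // expr1n.
  by rewrite -(ler_pM2l t0) tk mulr1.
rewrite s0 -(@ler_pXn2r R k) // ?nnegrE // sk expr1n invf_le1 //.
Qed.

(** [e] is the exponent of [rho] in [covered_factor] for T = rho^k; the target exponent is thus k (a
    - 1) + e. The inequality k <= e allows one rho^k to be combined with a factor t. *)
Lemma outer_exponent (a b k : nat) : (0 < k)%N -> (k <= b)%N ->
  let e := ('C(k.+1, 2) + k * (b - k))%N in
  (k * (a + b) - 'C(k.+1, 2) = k * a + e - k)%N /\ (k <= e)%N.
Proof.
move=> k0 kb; have -> : (b = (b - k) + k)%N by lia.
rewrite addnK; move: (b - k)%N => d /=.
move: 'C(k.+1, 2) (doublebin2 k) => c c2; rewrite !mulnDr.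
have h : (k * 1 <= k * k)%N by rewrite leq_mul2l; lia.
split; lia.
Qed.

(** For a given [c] there are O(t^(a-1) rho^e) pairs, and t^(a-1) rho^e = t^(a-2) (t rho^k)
    rho^(e-k). As a >= 2, each of the three factors is largest at the end of its range, so the crude
    product with the number of values of [c] loses only a constant. *)
Lemma covered_outer_ge2 (R : realType) (a b k : nat) :
  (1 < a)%N -> (0 < k)%N -> (k <= b)%N ->
  exists2 C : R, 0 <= C & forall y : R, 1 <= y ->
    covered (split_type a b 0 k (y ^+ k)) (C * y ^+ (k * (a + b) - 'C(k.+1, 2))).
Proof.
move=> a1 k0 kb; have aE : a.-1 = (a - 2).+1 by lia.
set E := (k * (a + b) - 'C(k.+1, 2))%N.
have [EE ke] := outer_exponent a k0 kb.
pose D : R := 3 ^+ a.-1 * (3 * 2 ^+ b) ^+ b.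
have D0 : 0 <= D by rewrite !mulr_ge0 ?exprn_ge0 // mulr_ge0 ?exprn_ge0.
pose w : R := 2 ^+ a; have w1 : 1 <= w by apply: exprn_ege1; rewrite ler1n.
exists (a%:R * 3 * D * w ^+ E).
  by rewrite !mulr_ge0 ?exprn_ge0 //; apply: le_trans w1.
move=> y y1; have y0 : 0 <= y by apply: le_trans y1.
set e := ('C(k.+1, 2) + k * (b - k))%N in EE ke.
pose Y := w * y; have Y1 : 1 <= Y by rewrite mulr_ege1.
have Y0 : 0 < Y by apply: lt_le_trans Y1.
pose B := D * (Y ^+ (k * (a - 2)) * (Y ^+ k * Y ^+ (e - k))).
have B0 : 0 <= B by rewrite !mulr_ge0 ?exprn_ge0 // ltW.
apply: (@covered_sub _ _ _ (fun f => exists2 i : nat, (i < a)%N &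
  exists2 c : int, `|c|%N%:R <= Y ^+ k & Num.max 1 `|c|%N%:R <= Y ^+ k /\
  forall rho : R, 0 <= rho -> Num.max 1 `|c|%N%:R * rho ^+ k = Y ^+ k ->
    outer_cell a b rho (rho ^+ k) i c f) (a%:R * ((3 * Y ^+ k) * B))).
- move=> f /(split_type_outer (ltnW a1) k0 y0)[i [c [ia cY hc]]].
  exists i => //; exists c => //.
  by apply: le_trans cY; rewrite le_max lexx orbT.
- apply: covered_bind; first by rewrite !mulr_ge0 ?exprn_ge0 // ltW.
    by exists (iota 0 a); rewrite ?size_iota // => i ia; rewrite mem_iota.
  move=> i ia; apply: covered_bind => //.
    by apply: covered_int_le; apply: exprn_ege1.
  move=> c _; apply: covered_nonempty => // -[_ [cY _]].
  set t : R := Num.max 1 _ in cY *.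
  have t1 : 1 <= t by rewrite le_max lexx.
  have [rho [s [r1 trho rhoE /andP[s0 s1] _]]] := outer_radius k0 (ltW Y0) t1 cY.
  have r0 : 0 <= rho by apply: le_trans r1.
  apply: (covered_sub _ (covered_outer_cell c ia r1 (exprn_ege1 k r1) kb)).
    by move=> f [_ h]; apply: h.
  rewrite -/t -[rho ^+ k ^+ _]exprM -exprD -/e exprMn mulrACA -/D /B ler_wpM2l //.
  rewrite aE.
  have -> : e = (k + (e - k))%N by rewrite subnKC.
  rewrite [rho ^+ _]exprD exprSr -mulrA [t * _]mulrA trho addKn exprM.
  apply: ler_pM; rewrite ?mulr_ge0 ?exprn_ge0 ?(ltW Y0) ?(le_trans ler01 t1) //.
    by rewrite lerXn2r ?nnegrE ?exprn_ge0 ?(ltW Y0) ?(le_trans ler01 t1).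
  rewrite ler_wpM2l ?exprn_ge0 ?(ltW Y0) // lerXn2r ?nnegrE ?(ltW Y0) //.
  by rewrite rhoE ler_piMr // ltW.
have -> : a%:R * (3 * Y ^+ k * B) = a%:R * 3 * D * Y ^+ E.
  rewrite /B -!exprD [3 * _ * _]mulrACA -exprD !mulrA.
  congr (_ * Y ^+ _); rewrite /E EE.
  have -> : (k * a = k * (a - 2) + k * 2)%N by rewrite -mulnDr subnK.
  lia.
by rewrite /Y exprMn !mulrA.
Qed.

(** For a given [c] there are O(rho^e) choices of [h], with rho = Y t^(-1/k), so the sum over [c] is
    controlled by that of t^(-e/k). Since 1 < b, one has e >= 3k/2, and [v] is the convergent
    majorant t^(-3/2). For b = k = 1 one would have e = k and a harmonic sum. *)
Lemma covered_outer_linear (R : realType) (b k : nat) :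
  (1 < b)%N -> (0 < k)%N -> (k <= b)%N ->
  exists2 C : R, 0 <= C & forall y : R, 1 <= y ->
    covered (split_type 1 b 0 k (y ^+ k)) (C * y ^+ (k * (1 + b) - 'C(k.+1, 2))).
Proof.
move=> b1 k0 kb; have [EE ke] := outer_exponent 1 k0 kb.
set e := ('C(k.+1, 2) + k * (b - k))%N in EE ke.
rewrite EE muln1 addKn.
have e3 : (3 * k <= 2 * e)%N.
  rewrite /e mulnDr doublebin2; move: kb b1; have [->|k1] := eqVneq k 1%N.
    by case: b {e EE ke} => [|[|b]] // _ _; rewrite subSS subn0 muln1; lia.
  have : (2 * k <= k * k)%N by rewrite leq_mul2r; lia.
  move: (k * (b - k))%N => d; rewrite mulSn; lia.
pose D : R := (3 * 2 ^+ b) ^+ b.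
have D0 : 0 <= D by rewrite exprn_ge0 // mulr_ge0 ?exprn_ge0.
(* 9 = 1 + 4 + 4: the term [c = 0], then the positive and the negative values of [c]. *)
exists (9 * (D * 2 ^+ e)); first by rewrite !mulr_ge0 ?exprn_ge0.
move=> y y1; have y0 : 0 <= y by apply: le_trans y1.
pose Y := 2 * y; have Y1 : 1 <= Y by rewrite mulr_ege1 // ler1n.
have Y0 : 0 < Y by apply: lt_le_trans Y1.
pose v (c : int) : R := let t := Num.max 1 `|c|%N%:R in (t * Num.sqrt t)^-1.
have v_ge0 c : 0 <= v c.
  by rewrite invr_ge0 mulr_ge0 ?sqrtr_ge0 // le_max ler01.
pose m := Num.truncn (Y ^+ k).
pose cs := Posz 0 :: [seq Posz i.+1 | i <- iota 0 m] ++ [seq - Posz i.+1 | i <- iota 0 m].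
apply: (@covered_sub _ _ _ (fun f => exists2 c : int, c \in cs &
  Num.max 1 `|c|%N%:R <= Y ^+ k /\
  forall rho : R, 0 <= rho -> Num.max 1 `|c|%N%:R * rho ^+ k = Y ^+ k ->
    outer_cell 1 b rho (rho ^+ k) 0 c f) (\sum_(c <- cs) (D * Y ^+ e * v c))).
- move=> f /(split_type_outer (ltn0Sn 0) k0 y0)[i [c [i1 cY hc]]].
  rewrite ltnS leqn0 in i1; move: hc; rewrite (eqP i1) => hc.
  exists c => //.
  have {}cY : (`|c| <= m)%N.
    rewrite truncn_ge_nat ?exprn_ge0 ?(ltW Y0) //.
    by apply: le_trans cY; rewrite le_max lexx orbT.
  rewrite /cs in_cons mem_cat; case: (intP c) cY => [|n|n] cm //; apply/orP; right; apply/orP.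
  - by left; apply/mapP; exists n; rewrite ?mem_iota //.
  - by right; apply/mapP; exists n; rewrite ?mem_iota // abszN in cm *.
- apply: covered_bigcup => c _; apply: covered_nonempty.
    by rewrite !mulr_ge0 ?exprn_ge0 ?(ltW Y0).
  move=> [_ [cY _]]; set t : R := Num.max 1 _ in cY *.
  have t1 : 1 <= t by rewrite le_max lexx.
  have t0 : 0 < t by apply: lt_le_trans t1.
  have [rho [s [r1 trho rhoE /andP[s0 s1] sk]]] := outer_radius k0 (ltW Y0) t1 cY.
  have r0 : 0 <= rho by apply: le_trans r1.
  apply: (covered_sub _ (covered_outer_cell c (ltn0Sn 0) r1 (exprn_ege1 k r1) kb)).
    by move=> f [_ h]; apply: h.
  rewrite expr0 mul1r -[rho ^+ k ^+ _]exprM -exprD -/e -/D -mulrA ler_wpM2l //.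
  rewrite rhoE exprMn ler_wpM2l ?exprn_ge0 ?(ltW Y0) // /v -/t.
  rewrite -(@ler_pXn2r R 2) // ?nnegrE ?exprn_ge0 //; last first.
    by rewrite invr_ge0 mulr_ge0 ?sqrtr_ge0 // ltW.
  rewrite -exprM mulnC exprVn exprMn sqr_sqrtr ?(ltW t0) //.
  apply: (@le_trans _ _ (s ^+ (3 * k))).
    by rewrite ler_wiXn2l.
  by rewrite mulnC exprM sk exprVn exprSr.
rewrite -mulr_sumr /Y exprMn [D * _]mulrA.
have -> : 9 * (D * 2 ^+ e) * y ^+ e = D * 2 ^+ e * y ^+ e * 9 by ring.
rewrite ler_wpM2l ?mulr_ge0 ?exprn_ge0 //.
rewrite /cs big_cons big_cat !big_map.
have v0 : v 0 = 1 by rewrite /v /= max_l // sqrtr1 mulr1 invr1.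
have vS (i : nat) : v (Posz i.+1) = (i.+1%:R * Num.sqrt i.+1%:R)^-1.
  by rewrite /v /= max_r // ler1n.
rewrite v0 (eq_bigr _ (fun i _ => vS i)) /=.
have h0 : 0 <= 4 / Num.sqrt m.+1%:R :> R by rewrite divr_ge0 ?sqrtr_ge0.
have := sum_inv_3half R m.
rewrite -(big_mkord xpredT (fun j => (j.+1%:R * Num.sqrt j.+1%:R)^-1)) /index_iota subn0.
by move=> h1; lra.
Qed.

(** * Upper bound over all types of factorization *)

Lemma covered_bigcup_ex (R : realType) (I T : eqType) (r : seq I)
    (S : I -> R -> T -> Prop) (w : R -> R) :
  (forall i, i \in r -> exists2 C : R, 0 <= C &
     forall y, 1 <= y -> covered (S i y) (C * w y)) ->
  exists2 C : R, 0 <= C & forall y, 1 <= y ->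
    covered (fun t => exists2 i, i \in r & S i y t) (C * w y).
Proof.
elim: r => [|i r IH] h.
  by exists 0 => // y _; exists [::]; rewrite ?mul0r // => t [].
have [C1 C10 h1] := h i (mem_head _ _).
have [C2 C20 h2] : exists2 C : R, 0 <= C & forall y, 1 <= y ->
    covered (fun t => exists2 i, i \in r & S i y t) (C * w y).
  by apply: IH => j jr; apply: h; rewrite in_cons jr orbT.
exists (C1 + C2); first exact: addr_ge0.
move=> y y1; rewrite mulrDl.
apply: (covered_sub _ (covered_or (h1 y y1) (h2 y y1))) => // t [j].
by rewrite in_cons => /orP[/eqP->|jr] Sj; [left|right; exists j].
Qed.

Lemma covered_split (R : realType) (a b p q : nat) :
  (0 < a)%N -> (0 < b)%N -> (2 < a + b)%N -> (0 < p + q)%N ->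
  exists2 C : R, 0 <= C & forall y : R, 1 <= y ->
    covered (split_type a b p q (y ^+ (p + q)))
      (C * y ^+ ((p + q) * (a + b) - 'C((p + q).+1, 2))).
Proof.
have swap (a' b' p' q' : nat) :
  (exists2 C : R, 0 <= C & forall y : R, 1 <= y ->
    covered (split_type b' a' q' p' (y ^+ (q' + p')))
      (C * y ^+ ((q' + p') * (b' + a') - 'C((q' + p').+1, 2)))) ->
  exists2 C : R, 0 <= C & forall y : R, 1 <= y ->
    covered (split_type a' b' p' q' (y ^+ (p' + q')))
      (C * y ^+ ((p' + q') * (a' + b') - 'C((p' + q').+1, 2))).
  move=> [C C0 h]; exists C => // y y1; rewrite addnC [(a' + b')%N]addnC.
  apply: (covered_sub _ (h y y1)) => // f; exact: split_typeC.
move=> a0 b0 ab pq.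
have [/andP[pa qb]|npq] := boolP ((p <= a)%N && (q <= b)%N); last first.
  exists 0 => // y _; exists [::]; rewrite ?mul0r // => f [g [h [r [_ gf hf _]]]].
  by case/negP: npq; rewrite (factor_type_count_le gf) (factor_type_count_le hf).
have outer (a' b' k : nat) : (0 < a')%N -> (2 < a' + b')%N -> (0 < k)%N -> (k <= b')%N ->
  exists2 C : R, 0 <= C & forall y : R, 1 <= y ->
    covered (split_type a' b' 0 k (y ^+ k)) (C * y ^+ (k * (a' + b') - 'C(k.+1, 2))).
  move=> a0' ab' k0 kb; case: (ltnP 1 a') => a1; first exact: covered_outer_ge2.
  have -> : a' = 1%N by lia.
  by apply: covered_outer_linear => //; lia.
have [p0|p0] := posnP p; first by subst p; apply: outer.
have [q0|q0] := posnP q.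
  by subst q; apply: swap; rewrite add0n; apply: outer => //; rewrite 1?addnC //; rewrite addnC in pq.
have [pqab|pqab] := ltnP (p + q) (a + b); last first.
  have -> : p = a by lia.
  have -> : q = b by lia.
  have [C C0 h] := covered_equimodular R a0 b0; exists C => // y y1.
  have -> : ((a + b) * (a + b) - 'C((a + b).+1, 2) = 'C(a + b, 2))%N.
    have := doublebin2 (a + b); rewrite binS bin1.
    by move: (a + b)%N => k c2; lia.
  exact: h.
(* A linear factor is set apart because the saving of [mixed_exponent] can fail for it. *)
have [a1|a1] := ltnP 1 a; last first.
  have a1' : a = 1%N by lia.
  have p1' : p = 1%N by lia.
  by subst a p; apply: covered_mixed_linear => //; lia.
have [b1|b1] := ltnP 1 b; last first.
  have b1' : b = 1%N by lia.
  have q1' : q = 1%N by lia.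
  by subst b q; apply: swap; apply: covered_mixed_linear => //; lia.
exact: covered_mixed_dyadic.
Qed.

Lemma covered_reducible_set (R : realType) (n k : nat) :
  (3 <= n)%N -> (1 <= k <= n)%N ->
  exists2 C : R, 0 <= C & forall H : nat, (1 <= H)%N ->
    covered (reducible_set R n k H) (C * H%:R `^ (n%:R - (k%:R + 1) / 2)).
Proof.
move=> n3 /andP[k1 kn]; pose E := (k * n - 'C(k.+1, 2))%N.
pose r := [seq (a, p) | a <- iota 1 n.-1, p <- iota 0 k.+1].
have [C C0 hC] : exists2 C : R, 0 <= C & forall y : R, 1 <= y ->
    covered (fun f => exists2 ap : nat * nat, ap \in r &
      split_type ap.1 (n - ap.1) ap.2 (k - ap.2) (y ^+ k) f) (C * y ^+ E).
  apply: covered_bigcup_ex => -[a p] /allpairsP[[a' p']] [].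
  move=> ha hp [-> ->].
  have p'k : (p' <= k)%N by move: hp; rewrite mem_iota add0n ltnS => /andP[].
  have /andP[a0 an] : (0 < a' < n)%N.
    by move: ha; rewrite mem_iota add1n prednK // (leq_trans _ n3).
  have := @covered_split R a' (n - a') p' (k - p'); rewrite !subnKC ?(ltnW an) // subn_gt0.
  exact.
exists (C * n`!%:R `^ (n%:R - (k%:R + 1) / 2)); first by rewrite mulr_ge0 ?powR_ge0.
move=> H H1; have X1 : 1 <= (n`!%:R * H%:R : R).
  by rewrite -natrM ler1n muln_gt0 fact_gt0.
pose X : R := n`!%:R * H%:R; pose y := X `^ k%:R^-1.
have X0 : 0 <= X by apply: le_trans X1.
have y1 : 1 <= y by rewrite -(powRr0 X); apply: ler_powR => //; rewrite invr_ge0.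
have k0 : k%:R != 0 :> R by rewrite pnatr_eq0 -lt0n.
have yk : y ^+ k = X.
  by rewrite -powR_mulrn ?powR_ge0 // /y -powRrM mulVf // powRr1.
have yE : y ^+ E = n`!%:R `^ (n%:R - (k%:R + 1) / 2) * H%:R `^ (n%:R - (k%:R + 1) / 2).
  rewrite -powRM // -/X -powR_mulrn ?powR_ge0 // /y -powRrM; congr (_ `^ _).
  apply: (mulfI k0); rewrite mulrA mulfV // mul1r /E natrB; last first.
    have := doublebin2 k; have := leq_mul (leqnn k) kn.
    have := leq_mul (leqnn k) k1; lia.
  have : (2 * 'C(k.+1, 2))%N%:R = (k.+1 * k)%N%:R :> R by rewrite doublebin2.
  rewrite !natrM -[k.+1%:R]natr1; lra.
rewrite -mulrA -yE; apply: (covered_sub _ (hC y y1)) => // f.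
move=> /reducible_set_factor[g [h [a [b [p [q [r0 [fE [a0 b0 ab pq] gf hf M]]]]]]]].
exists (a, p).
  by apply/allpairsP; exists (a, p); rewrite !mem_iota; split => //=; lia.
have -> : (n - a = b)%N by lia.
have -> : (k - p = q)%N by lia.
by exists g, h, r0; rewrite yk.
Qed.

(** * Polynomials with many roots of equal modulus *)

(* [x ^ m * Q (x + a / x)]: a root [c] of [Q] becomes the pair of roots of [x ^
   2 - c x + a]. *)
Definition reciprocal_lift (A : comNzRingType) (a : A) (m : nat) (Q : {poly A}) : {poly A} :=
  \sum_(i < m.+1) Q`_i *: ('X^(m - i) * ('X^2 + a%:P) ^+ i).

Lemma reciprocal_liftB (A : comNzRingType) (a : A) (m : nat) (P Q : {poly A}) :
  reciprocal_lift a m (P - Q) = reciprocal_lift a m P - reciprocal_lift a m Q.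
Proof. by rewrite -sumrB; apply: eq_bigr => i _; rewrite coefB scalerBl. Qed.

Lemma reciprocal_lift_XsubC (A : comNzRingType) (a c : A) (m : nat) (Q : {poly A}) :
  (size Q <= m.+1)%N ->
  reciprocal_lift a m.+1 (('X - c%:P) * Q) =
    ('X^2 + a%:P - c *: 'X) * reciprocal_lift a m Q.
Proof.
move=> sQ; rewrite /reciprocal_lift [RHS]mulrBl.
have -> : ('X^2 + a%:P) * (\sum_(i < m.+1) Q`_i *: ('X^(m - i) * ('X^2 + a%:P) ^+ i)) =
    \sum_(i < m.+2) (if (i : nat) is j.+1 then Q`_j else 0) *: ('X^(m.+1 - i) * ('X^2 + a%:P) ^+ i).
  rewrite [RHS]big_ord_recl scale0r add0r mulr_sumr; apply: eq_bigr => i _.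
  by rewrite -scalerAr /= subSS mulrCA -exprS.
have -> : c *: 'X * (\sum_(i < m.+1) Q`_i *: ('X^(m - i) * ('X^2 + a%:P) ^+ i)) =
    \sum_(i < m.+2) (c * Q`_i) *: ('X^(m.+1 - i) * ('X^2 + a%:P) ^+ i).
  rewrite [RHS]big_ord_recr /= [Q`_m.+1]nth_default // mulr0 scale0r addr0 mulr_sumr.
  apply: eq_bigr => i _; rewrite -scalerAl -scalerAr scalerA mulrA -exprS subSn //.
  by rewrite -ltnS.
rewrite -sumrB; apply: eq_bigr => i _.
by rewrite mulrBl coefB coefXM coefCM scalerBl; case: (i : nat).
Qed.

Lemma reciprocal_lift_prod (A : comNzRingType) (a : A) (cs : seq A) :
  reciprocal_lift a (size cs) (\prod_(c <- cs) ('X - c%:P)) =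
    \prod_(c <- cs) ('X^2 + a%:P - c *: 'X).
Proof.
elim: cs => [|c cs IH].
  by rewrite !big_nil /reciprocal_lift big_ord1 coef1 scale1r !expr0 mulr1.
by rewrite !big_cons reciprocal_lift_XsubC ?IH // size_prod_XsubC.
Qed.

Lemma map_reciprocal_lift (A B : comNzRingType) (f : {rmorphism A -> B}) (a : A)
    (m : nat) (Q : {poly A}) :
  map_poly f (reciprocal_lift a m Q) = reciprocal_lift (f a) m (map_poly f Q).
Proof.
rewrite rmorph_sum; apply: eq_bigr => i _ /=.
by rewrite map_polyZ rmorphM !rmorphXn rmorphD /= map_polyXn map_polyC map_polyX coef_map.
Qed.

(** The polynomials x^(m-i) (x^2 + a)^i are monic of distinct degrees m + i, hence linearly
    independent: the coefficient of degree m + deg D of the lift is the leading coefficient of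
    [D]. *)
Lemma reciprocal_lift_eq0 (A : comNzRingType) (a : A) (m : nat) (D : {poly A}) :
  (size D <= m.+1)%N -> reciprocal_lift a m D = 0 -> D = 0.
Proof.
move=> sD /polyP lift0; apply/eqP; apply: contraT => D0.
have sD0 : (0 < size D)%N by rewrite lt0n size_poly_eq0.
have Ym : 'X^2 + a%:P \is monic.
  by rewrite monicE lead_coefDl ?lead_coefXn // size_polyXn (leq_ltn_trans (size_polyC_leq1 _)).
have sY i : size ('X^(m - i) * ('X^2 + a%:P) ^+ i) = (m - i + (2 * i)).+1.
  rewrite size_monicM ?monicXn ?monic_neq0 ?monic_exp // size_polyXn.
  have sY1 : size ('X^2 + a%:P) = 3%N.
    by rewrite size_polyDl size_polyXn // (leq_ltn_trans (size_polyC_leq1 _)).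
  have -> : size (('X^2 + a%:P) ^+ i) = (2 * i).+1.
    elim: i => [|i IH]; first by rewrite expr0 size_poly1.
    by rewrite exprS size_monicM ?monic_neq0 ?monic_exp // IH sY1; lia.
  lia.
pose i0 := (size D).-1; have i0m : (i0 < m.+1)%N by rewrite /i0; lia.
have := lift0 (m + i0)%N; rewrite coef0 coef_sum (bigD1 (Ordinal i0m)) //= big1.
  rewrite addr0 coefZ.
  have -> : ('X^(m - i0) * ('X^2 + a%:P) ^+ i0)`_(m + i0) = 1.
    have /monicP : 'X^(m - i0) * ('X^2 + a%:P) ^+ i0 \is monic.
      by rewrite monicMl ?monicXn ?monic_exp.
    rewrite lead_coefE sY /=; have -> : (m - i0 + 2 * i0 = m + i0)%N by lia.
    by [].
  by rewrite mulr1 -lead_coefE => /eqP; rewrite lead_coef_eq0 (negPf D0).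
move=> [i im] ne; rewrite coefZ /=; have {}ne : i != i0 by apply: contraNneq ne => ei; apply/eqP/val_inj.
have [ii0|ii0] := ltnP i i0.
  by rewrite [X in _ * X]nth_default ?mulr0 // sY; lia.
by rewrite [D`_i]nth_default ?mul0r // -(prednK sD0) ltn_neqAle eq_sym ne ii0.
Qed.

Lemma reciprocal_lift_inj (A : comNzRingType) (a : A) (m : nat) (P Q : {poly A}) :
  (size P <= m.+1)%N -> (size Q <= m.+1)%N ->
  reciprocal_lift a m P = reciprocal_lift a m Q -> P = Q.
Proof.
move=> sP sQ PQ; apply/eqP; rewrite -subr_eq0; apply/eqP.
apply: (@reciprocal_lift_eq0 _ a m); last by rewrite reciprocal_liftB PQ subrr.
by apply: leq_trans (size_polyD _ _) _; rewrite size_polyN geq_max sP.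
Qed.

(** The discriminant c^2 - 4 s^2 is at most 0, so the two roots are conjugate with product s^2. *)
Lemma quadratic_roots (R : realType) (s c : R) : 0 <= s -> `|c| <= 2 * s ->
  exists z1 z2 : R[i], [/\ nc z1 = s, nc z2 = s &
    'X^2 + ((s ^+ 2)%:C)%C%:P - (c%:C)%C *: 'X = ('X - z1%:P) * ('X - z2%:P)].
Proof.
move=> s0 cs; pose w := Num.sqrt (s ^+ 2 - (c / 2) ^+ 2).
have w2 : w ^+ 2 = s ^+ 2 - (c / 2) ^+ 2.
  rewrite sqr_sqrtr // subr_ge0 -[(c / 2) ^+ 2]real_normK ?num_real //.
  rewrite lerXn2r ?nnegrE // normrM [X in _ * X]ger0_norm ?invr_ge0 //.
  by rewrite ler_pdivrMr // mulrC.
pose z1 : R[i] := (c / 2 +i* w)%C; pose z2 : R[i] := (c / 2 -i* w)%C.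
have n1 : nc z1 = s.
  by rewrite /Normc.normc /= w2 addrC subrK sqrtr_sqr ger0_norm.
have n2 : nc z2 = s.
  by rewrite /Normc.normc /= sqrrN w2 addrC subrK sqrtr_sqr ger0_norm.
exists z1, z2; split=> //.
have sumE : z1 + z2 = (c%:C)%C.
  by rewrite /z1 /z2; apply/eqP; rewrite eq_complex /= subrr eqxx andbT; apply/eqP; field.
have prodE : z1 * z2 = ((s ^+ 2)%:C)%C.
  rewrite /z1 /z2; apply/eqP; rewrite eq_complex /=; apply/andP; split; apply/eqP.
    by move: w2; nra.
  by ring.
rewrite -sumE -prodE -mul_polyC !rmorphD !rmorphM /=; ring.
Qed.

Lemma reciprocal_lift_roots (R : realType) (s : R) (cs : seq R) :
  0 <= s -> (forall c, c \in cs -> `|c| <= 2 * s) ->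
  exists zs : seq R[i], [/\ size zs = (2 * size cs)%N, (forall z, z \in zs -> nc z = s) &
    map_poly (real_complex R) (reciprocal_lift (s ^+ 2) (size cs) (\prod_(c <- cs) ('X - c%:P)))
      = rootpoly zs].
Proof.
move=> s0; rewrite reciprocal_lift_prod rmorph_prod.
elim: cs => [|c cs IH] hcs.
  by exists [::]; rewrite /rootpoly !big_nil.
have [|zs [szs hzs zsE]] := IH _; first by move=> x xs; apply: hcs; rewrite in_cons xs orbT.
have [|z1 [z2 [n1 n2 E]]] := @quadratic_roots R s c s0 _; first by apply: hcs; rewrite mem_head.
exists [:: z1, z2 & zs]; split=> /=; first by rewrite szs; lia.
  by move=> z; rewrite !in_cons => /or3P[/eqP->|/eqP->|/hzs].
rewrite big_cons zsE /rootpoly !big_cons mulrA -E; congr (_ * _).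
by rewrite rmorphB rmorphD /= map_polyXn map_polyC map_polyZ map_polyX.
Qed.

(* The roots of the reference polynomial: midpoints of the [m] equal parts of
   [0, s]. *)
Definition grid_poly (R : realType) (m : nat) (s : R) : {poly R} :=
  \prod_(j < m) ('X - (s * ((2 * j).+1%:R / (2 * m)%:R))%:P).

Lemma grid_poly_horner (R : realType) (m l : nat) (s : R) : (0 < m)%N ->
  (grid_poly m s).[s * (l%:R / m%:R)] =
    \prod_(j < m) (s * (((2 * l)%:R - (2 * j).+1%:R) / (2 * m)%:R)).
Proof.
move=> m0; rewrite /grid_poly horner_prod; apply: eq_bigr => j _.
rewrite hornerXsubC -mulrBr; congr (_ * _); rewrite mulrBl; congr (_ - _).
by rewrite !natrM; field; rewrite pnatr_eq0 -lt0n.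
Qed.

(** The difference of an even and an odd integer has absolute value at least 1, so each linear
    factor is at least s / (2 m) in absolute value at the point s l / m. *)
Lemma grid_poly_large (R : realType) (m l : nat) (s : R) : (0 < m)%N -> 0 <= s ->
  ((2 * m)%:R^-1 * s) ^+ m <= `|(grid_poly m s).[s * (l%:R / m%:R)]|.
Proof.
move=> m0 s0; rewrite grid_poly_horner // normr_prod.
rewrite -[X in _ ^+ X]card_ord -prodr_const; apply: ler_prod => j _.
rewrite mulr_ge0 ?invr_ge0 //= normrM ger0_norm // mulrC ler_wpM2l //.
rewrite normrM [X in _ * X]ger0_norm ?invr_ge0 // ler_peMl ?invr_ge0 //.
have -> : (2 * l)%:R - (2 * j).+1%:R = ((2 * l)%:Z - (2 * j).+1%:Z)%:~R :> R.
  by rewrite rmorphB.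
rewrite -intr_norm -[1]/(1%:~R) ler_int; lia.
Qed.

(** Pairing the factors of index j at both points gives a positive multiple of 4 (l - j)^2 - 1,
    which is negative for j = l only. *)
Lemma grid_poly_alternates (R : realType) (m l : nat) (s : R) : (l < m)%N -> 0 < s ->
  (grid_poly m s).[s * (l%:R / m%:R)] * (grid_poly m s).[s * (l.+1%:R / m%:R)] < 0.
Proof.
move=> lm s0; have m0 : (0 < m)%N by apply: leq_ltn_trans lm.
rewrite !grid_poly_horner // -big_split /= (bigD1 (Ordinal lm)) //=.
have c0 : 0 < (2 * m)%:R^-1 :> R by rewrite invr_gt0 ltr0n muln_gt0.
have fE (j : nat) : s * (((2 * l)%:R - (2 * j).+1%:R) / (2 * m)%:R) *
    (s * (((2 * l.+1)%:R - (2 * j).+1%:R) / (2 * m)%:R)) =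
    (s / (2 * m)%:R) ^+ 2 * (4 * (l%:R - j%:R) ^+ 2 - 1).
  move: (2 * m)%:R^-1 => c; rewrite -[(2 * j).+1%:R]natr1 ![(2 * _)%:R]natrM.
  by rewrite -[l.+1%:R]natr1; ring.
have cs0 : 0 < (s / (2 * m)%:R) ^+ 2 by rewrite exprn_gt0 // mulr_gt0.
rewrite nmulr_rlt0.
  apply: prodr_gt0 => j jl; rewrite fE mulr_gt0 // subr_gt0.
  have : (j : nat) != l by apply: contraNneq jl => jl; apply/eqP/val_inj.
  rewrite neq_ltn => /orP[]; rewrite -(ler_nat R) -natr1; nra.
by rewrite fE pmulr_rlt0 // subrr; lra.
Qed.

(** The leading terms cancel, and each of the [m] remaining terms is at most eps s^m on [0, s]. *)
Lemma perturbed_grid_horner (R : realType) (m : nat) (s eps y : R) (Q : {poly R}) :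
  0 <= y -> y <= s -> Q \is monic -> size Q = m.+1 ->
  (forall i, (i < m)%N -> `|Q`_i - (grid_poly m s)`_i| <= eps * s ^+ (m - i)) ->
  `|Q.[y] - (grid_poly m s).[y]| <= m%:R * eps * s ^+ m.
Proof.
move=> y0 ys Qm sQ hQ; rewrite -hornerN -hornerD.
have s0 : 0 <= s by apply: le_trans ys.
have gm : grid_poly m s \is monic by apply: monic_prod_XsubC.
have sg : size (grid_poly m s) = m.+1.
  rewrite /grid_poly -(big_mkord xpredT (fun j => 'X - (s * ((2 * j).+1%:R / (2 * m)%:R))%:P)).
  by rewrite size_prod_XsubC size_iota subn0.
have sD : (size (Q - grid_poly m s)%R <= m)%N.
  apply/leq_sizeP => j; rewrite leq_eqVlt => /orP[/eqP<-|mj]; rewrite coefB.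
    have := monicP Qm; have := monicP gm; rewrite !lead_coefE sQ sg /= => -> ->.
    by rewrite subrr.
  by rewrite !nth_default ?subrr ?sQ ?sg.
rewrite (horner_coef_wide _ sD); apply: (le_trans (ler_norm_sum _ _ _)).
have -> : m%:R * eps * s ^+ m = \sum_(i < m) (eps * s ^+ m).
  by rewrite sumr_const card_ord -[RHS]mulr_natl mulrA.
apply: ler_sum => i _; rewrite normrM coefB normrX (ger0_norm y0).
have im : (i <= m)%N by apply: ltnW.
rewrite -[in leRHS](subnK im) exprD mulrA; apply: ler_pM; rewrite ?exprn_ge0 //.
  exact: hQ.
by rewrite lerXn2r ?nnegrE.
Qed.

(** At the points s l / m with l <= m, the perturbation is smaller than the value of [grid_poly], so
    [Q] alternates in sign there as well. This gives a root in each of the [m] intervals, hence all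
    the roots of [Q]. *)
Lemma perturbed_grid_roots (R : realType) (m : nat) (s eps : R) (Q : {poly R}) :
  0 < s -> m%:R * eps < ((2 * m)%:R^-1) ^+ m -> Q \is monic -> size Q = m.+1 ->
  (forall i, (i < m)%N -> `|Q`_i - (grid_poly m s)`_i| <= eps * s ^+ (m - i)) ->
  exists cs : seq R, [/\ size cs = m, (forall c, c \in cs -> `|c| <= 2 * s) &
    Q = \prod_(c <- cs) ('X - c%:P)].
Proof.
move=> s0 heps Qm sQ hQ; have [m0|m0] := posnP m.
  exists [::]; rewrite m0 in sQ *; split=> //; rewrite big_nil.
  apply/polyP => i; rewrite coef1; case: i => [|i]; last by rewrite nth_default // sQ.
  by have := monicP Qm; rewrite lead_coefE sQ.
pose y (l : nat) : R := s * (l%:R / m%:R).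
have m0R : 0 < m%:R :> R by rewrite ltr0n.
have y_le (l l' : nat) : (l <= l')%N -> y l <= y l'.
  by move=> ll; rewrite /y ler_pM2l // ler_pM2r ?invr_gt0 // ler_nat.
have y0 l : 0 <= y l by rewrite /y !mulr_ge0 ?invr_ge0 // ltW.
have ym : y m = s by rewrite /y divff ?mulr1 // gt_eqF.
have same_sign (l : nat) : (l <= m)%N -> 0 < Q.[y l] * (grid_poly m s).[y l].
  move=> lm; have h1 := grid_poly_large l m0 (ltW s0).
  have yls : y l <= s by rewrite -ym y_le.
  have h2 := perturbed_grid_horner (y0 l) yls Qm sQ hQ.
  have h3 : m%:R * eps * s ^+ m < ((2 * m)%:R^-1 * s) ^+ m.
    by rewrite exprMn ltr_pM2r // exprn_gt0.
  rewrite -/(y l) in h1.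
  have : `|Q.[y l] - (grid_poly m s).[y l]| < `|(grid_poly m s).[y l]|.
    exact: le_lt_trans h2 (lt_le_trans h3 h1).
  move: Q.[y l] (grid_poly m s).[y l] => u v.
  case: (ger0P v) => v0; rewrite ltr_norml => /andP[] *; nra.
have ivt (l : 'I_m) : exists x : R, y l < x < y l.+1 /\ root Q x.
  have lm := ltn_ord l.
  have neg : Q.[y l] * Q.[y l.+1] < 0.
    have := grid_poly_alternates lm s0; rewrite -/(y l) -/(y l.+1).
    have := same_sign l (ltnW lm); have := same_sign l.+1 lm.
    move: Q.[y l] Q.[y l.+1] (grid_poly m s).[y l] (grid_poly m s).[y l.+1] => u u' v v' h1 h2 h3.
    rewrite -(pmulr_llt0 _ (mulr_gt0 h2 h1)).
    have -> : u * u' * (u * v * (u' * v')) = (u * u') ^+ 2 * (v * v') by ring.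
    rewrite pmulr_rlt0 // exprn_even_gt0 //= mulf_neq0 //.
      by apply: contraTneq h2 => ->; rewrite mul0r ltxx.
    by apply: contraTneq h1 => ->; rewrite mul0r ltxx.
  have [x xin rx] := polyrcf.poly_ivtoo (y_le _ _ (leqnSn l)) neg.
  by exists x; split=> //; move: xin; rewrite in_itv.
have [c hc] := choice ivt.
pose cs := [seq c l | l <- enum 'I_m]; exists cs.
have scs : size cs = m by rewrite size_map size_enum_ord.
split=> //.
  move=> _ /mapP[l _ ->]; have [/andP[h1 h2] _] := hc l.
  have h3 : 0 <= c l by apply: ltW (le_lt_trans (y0 _) h1).
  have h4 : c l <= s by apply: ltW (lt_le_trans h2 _); rewrite -ym y_le.
  rewrite ger0_norm //; lra.
have c_lt (l l' : 'I_m) : (l < l')%N -> c l < c l'.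
  move=> ll; have [/andP[_ h2] _] := hc l; have [/andP[h1 _] _] := hc l'.
  by apply: lt_trans h2 (le_lt_trans (y_le _ _ ll) h1).
have c_inj : injective c.
  by move=> l l' cl; apply/val_inj; case: (ltngtP l l') => // /c_lt; rewrite cl ltxx.
have QE : Q = lead_coef Q *: \prod_(c <- cs) ('X - c%:P).
  apply: all_roots_prod_XsubC; first by rewrite sQ scs.
    by apply/allP => x /mapP[j _ ->]; have [] := hc j.
  by rewrite uniq_rootsE map_inj_uniq // enum_uniq.
by rewrite {1}QE (monicP Qm) scale1r.
Qed.

(** * Boxes of integer polynomials and their products *)

Fixpoint monic_box (m : nat) (c : nat -> int) (W : nat -> nat) : seq {poly int} :=
  if m is m'.+1 then
    [seq g * 'X + (c 0%N + w%:Z)%:P | g <- monic_box m' (c \o S) (W \o S), w <- iota 0 (W 0%N)]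
  else [:: 1].

Lemma monic_box_uniq (m : nat) (c : nat -> int) (W : nat -> nat) :
  uniq (monic_box m c W).
Proof.
elim: m c W => [//|m IH] c W; apply: allpairs_uniq; rewrite ?iota_uniq ?IH //.
move=> [g w] [g' w'] _ _ /= /polyP E; have := E 0%N.
rewrite !coefD !coefMX !coefC /= !add0r => /addrI [->]; congr (_, _).
apply/polyP => i; have := E i.+1.
by rewrite !coefD !coefMX !coefC /= !addr0.
Qed.

Lemma size_monic_box (m : nat) (c : nat -> int) (W : nat -> nat) :
  size (monic_box m c W) = (\prod_(i < m) W i)%N.
Proof.
elim: m c W => [|m IH] c W; first by rewrite big_ord0.
by rewrite /= size_allpairs IH size_iota big_ord_recl mulnC.
Qed.

Lemma monic_boxP (m : nat) (c : nat -> int) (W : nat -> nat) (g : {poly int}) :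
  g \in monic_box m c W -> [/\ g \is monic, size g = m.+1 &
    forall i, (i < m)%N -> c i <= g`_i < c i + (W i)%:Z].
Proof.
elim: m c W g => [|m IH] c W g.
  by rewrite inE => /eqP->; rewrite monic1 size_poly1.
move=> /allpairsP[[h w] /= [/IH[hm sh hC] wW ->]].
have h0 : h != 0 by rewrite monic_neq0.
have sg : size (h * 'X + (c 0%N + w%:Z)%:P) = m.+2.
  by rewrite size_MXaddC (negPf h0) /= sh.
split=> //.
  rewrite monicE lead_coefE sg coefD coefMX coefC /= addr0.
  by have := monicP hm; rewrite lead_coefE sh /= => ->.
move=> [|i] im; rewrite coefD coefMX coefC /=; last by rewrite addr0; apply: hC.
by rewrite add0r; move: wW; rewrite mem_iota; lia.
Qed.

Lemma uniq_flatten_disjoint (I T : eqType) (r : seq I) (F : I -> seq T) :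
  uniq r -> (forall i, i \in r -> uniq (F i)) ->
  (forall i j x, i \in r -> j \in r -> x \in F i -> x \in F j -> i = j) ->
  uniq (flatten [seq F i | i <- r]).
Proof.
elim: r => //= i r IH /andP[ir ur] uF dF.
rewrite cat_uniq uF ?mem_head //= IH //; last 2 first.
- by move=> j jr; apply: uF; rewrite in_cons jr orbT.
- by move=> j j' x jr jr'; apply: dF; rewrite in_cons ?jr ?jr' orbT.
rewrite andbT; apply/hasPn => x /flattenP[_ /mapP[j jr ->] xj].
apply/negP => xi; case/negP: ir.
by rewrite (dF i j x) ?mem_head // in_cons jr orbT.
Qed.

(** By 2 <= delta s every width x is at least 2, so that its integer part is at least x / 2. *)
Lemma staircase_widths (R : realType) (m : nat) (delta s : R) :
  0 < delta -> 1 <= s -> 2 <= delta * s ->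
  (delta / 2) ^+ m * s ^+ 'C(m.+1, 2) <=
    (\prod_(i < m) Num.truncn (delta * s ^+ (m - i)))%N%:R.
Proof.
move=> d0 s1 ds; rewrite natr_prod; have s0 : 0 < s by apply: lt_le_trans s1.
have := prod_staircase s 1 m m; rewrite minnn expr1n mulr1 => <-.
rewrite -[X in _ ^+ X * _]card_ord -prodr_const -big_split /=.
apply: ler_prod => i _; rewrite leq_subr.
rewrite mulr_ge0 ?exprn_ge0 ?divr_ge0 ?(ltW d0) ?(ltW s0) //=.
have h1 : 2 <= delta * s ^+ (m - i).
  apply: (le_trans ds); rewrite ler_pM2l //; apply: ler_eXnr => //.
  by rewrite subn_gt0.
have := truncnS_gt (delta * s ^+ (m - i)); rewrite -natr1.
have -> : delta / 2 * s ^+ (m - i) = delta * s ^+ (m - i) / 2 by ring.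
move: (delta * _) h1 => x h1 h2; lra.
Qed.

(** At a point of modulus |z| >= s each of the [d] lower terms is at most |z|^d / (2 d), so together
    they cannot cancel z^d. *)
Lemma roots_lt_of_small_coef (R : realType) (s : R) (d : nat) (h : {poly int}) :
  0 < s -> h \is monic -> size h = d.+1 ->
  (forall i, (i < d)%N -> `|(h`_i)%R|%N%:R <= (2 * d)%:R^-1 * s ^+ (d - i)) ->
  forall z, z \in zroots R h -> nc z < s.
Proof.
move=> s0 hm sh hc z zh; rewrite ltNge; apply/negP => sz.
have hz : (intpoly R h).[z] = 0.
  by apply/eqP; rewrite -/(root _ z) intpolyE // root_prod_XsubC.
have z0 : 0 < nc z by apply: lt_le_trans sz.
have d0 : (0 < d)%N.
  rewrite lt0n; apply: contraTneq zh => d0.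
  by have := size_zroots R hm; rewrite sh d0; case: (zroots R h).
rewrite horner_coef size_intpoly sh big_ord_recr /= in hz.
have lead : (intpoly R h)`_d = 1.
  have := monicP hm; rewrite lead_coefE sh /= => hd.
  by rewrite coef_map_id0 // hd.
rewrite lead mul1r in hz.
have h1 : nc z ^+ d = nc (\sum_(i < d) (intpoly R h)`_i * z ^+ i).
  have -> : \sum_(i < d) (intpoly R h)`_i * z ^+ i = - z ^+ d.
    by apply/eqP; rewrite -addr_eq0 hz.
  rewrite normc_opp; elim: (d) => [|e IH]; first by rewrite !expr0 nc1.
  by rewrite !exprS Normc.normcM IH.
have normX i : nc (z ^+ i) = nc z ^+ i.
  by elim: i => [|e IH]; rewrite ?expr0 ?nc1 // !exprS Normc.normcM IH.
have tri (n : nat) (F : nat -> R[i]) : nc (\sum_(i < n) F i) <= \sum_(i < n) nc (F i).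
  elim: n => [|n IH]; first by rewrite !big_ord0 nc0.
  by rewrite !big_ord_recr /=; apply: le_trans (ler_normcD _ _) _; rewrite lerD2r.
have h2 : nc z ^+ d <= \sum_(i < d) (2 * d)%:R^-1 * nc z ^+ d.
  rewrite {1}h1; apply: le_trans (tri d (fun i => (intpoly R h)`_i * z ^+ i)) _.
  apply: ler_sum => i _; rewrite Normc.normcM normX normc_coef_intpoly.
  have im : (i <= d)%N by apply: ltnW.
  have -> : nc z ^+ d = nc z ^+ (d - i) * nc z ^+ i by rewrite -exprD subnK.
  rewrite mulrA ler_wpM2r ?exprn_ge0 ?(ltW z0) //.
  apply: (le_trans (hc i (ltn_ord i))); rewrite ler_wpM2l ?invr_ge0 //.
  by rewrite lerXn2r ?nnegrE ?(ltW z0) ?(ltW s0).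
move: h2; rewrite sumr_const card_ord -[leRHS]mulr_natl [leRHS]mulrA natrM invfM.
have d0R : 0 < d%:R :> R by rewrite ltr0n.
rewrite [2^-1 * _]mulrC [d%:R * _]mulrA mulfV ?gt_eqF // mul1r.
have : 0 < nc z ^+ d by rewrite exprn_gt0.
lra.
Qed.

(** Makes m times the width smaller than (2 m)^(-m), as [perturbed_grid_roots] requires; the
    successor in the denominator keeps the width positive for m = 0. *)
Definition lift_width (R : realType) (m : nat) : R :=
  (2 * m)%:R^-1 ^+ m / (2 * m.+1)%:R.

(** At most the 1 / (2 d) of [roots_lt_of_small_coef] when d > 0, and positive for d = 0 too. *)
Definition tail_width (R : realType) (d : nat) : R := (2 * d.+1)%:R^-1.

Definition lift_box (R : realType) (m : nat) (s : R) : seq {poly int} :=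
  monic_box m (fun i => Num.floor (grid_poly m s)`_i)
    (fun i => Num.truncn (lift_width R m * s ^+ (m - i))).

Definition tail_box (R : realType) (d : nat) (s : R) : seq {poly int} :=
  monic_box d (fun=> 0) (fun i => Num.truncn (tail_width R d * s ^+ (d - i))).

Lemma lift_width_gt0 (R : realType) (m : nat) : 0 < lift_width R m.
Proof.
rewrite /lift_width divr_gt0 ?ltr0n //; case: m => [|m]; first by rewrite expr0.
by rewrite exprn_gt0 // invr_gt0 ltr0n.
Qed.

Lemma tail_width_gt0 (R : realType) (d : nat) : 0 < tail_width R d.
Proof. by rewrite /tail_width invr_gt0 ltr0n. Qed.

Lemma lift_boxP (R : realType) (m : nat) (s : R) (A : int) (Q : {poly int}) :
  0 < s -> s ^+ 2 = A%:~R -> Q \in lift_box m s ->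
  [/\ Q \is monic, size Q = m.+1, reciprocal_lift A m Q \is monic &
   exists zs : seq R[i], [/\ size zs = (2 * m)%N, forall z, z \in zs -> nc z = s &
     intpoly R (reciprocal_lift A m Q) = rootpoly zs]].
Proof.
move=> s0 sA /monic_boxP[Qm sQ hQ].
pose QR := map_poly (intr : int -> R) Q.
have QRm : QR \is monic by apply: monic_map.
have sQR : size QR = m.+1 by rewrite size_map_inj_poly //; apply: intr_inj.
have lw := lift_width_gt0 R m.
have heps : m%:R * lift_width R m < (2 * m)%:R^-1 ^+ m.
  have mm0 : 0 < ((2 * m)%:R^-1 : R) ^+ m.
    case: (m) => [|m']; first by rewrite expr0.
    by rewrite exprn_gt0 // invr_gt0 ltr0n.
  rewrite /lift_width mulrCA -[ltRHS]mulr1 ltr_pM2l // ltr_pdivrMr ?ltr0n // mul1r ltr_nat; lia.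
have hQR (i : nat) : (i < m)%N ->
    `|QR`_i - (grid_poly m s)`_i| <= lift_width R m * s ^+ (m - i).
  move=> im; have /andP[h1 h2] := hQ i im; rewrite coef_map_id0 //.
  set W := Num.truncn _ in h2 *.
  have W0 : W%:R <= lift_width R m * s ^+ (m - i).
    by rewrite truncn_le mulr_ge0 ?exprn_ge0 // ltW.
  (* The box is not empty, so [W] is at least 1; this covers the error made in rounding the corner
     of the box down. *)
  have W1 : (0 < W)%N by lia.
  apply: le_trans W0; move: h1 h2; set x := (grid_poly m s)`_i; set q := Q`_i => h1 h2.
  have /andP[f1 f2] := floor_itv x.
  have h1' : (Num.floor x)%:~R <= q%:~R :> R by rewrite ler_int.
  have h2' : (q + 1)%:~R <= (Num.floor x + W%:Z)%:~R :> R by rewrite ler_int; lia.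
  have W1' : 1 <= W%:R :> R by rewrite ler1n.
  rewrite !rmorphD /= in f2 h2'.
  rewrite ler_norml; apply/andP; split; last by lra.
  lra.
have [cs [scs hcs QE]] := perturbed_grid_roots s0 heps QRm sQR hQR.
have [zs [szs hzs zsE]] := reciprocal_lift_roots (ltW s0) hcs.
rewrite -QE scs sA in zsE.
have E : intpoly R (reciprocal_lift A m Q) = rootpoly zs.
  rewrite -zsE -[A%:~R]/(intr A) -(map_reciprocal_lift (intr : {rmorphism int -> R})) -map_poly_comp.
  by apply: eq_map_poly => x /=; rewrite rmorph_int.
split=> //; last by exists zs; rewrite szs scs.
rewrite monicE; apply/eqP/(@intr_complex_inj R).
have <- : lead_coef (intpoly R (reciprocal_lift A m Q)) = (lead_coef (reciprocal_lift A m Q))%:~R.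
  by apply: lead_coef_map_inj => //; apply: intr_complex_inj.
by rewrite E; apply/monicP/monic_prod_XsubC.
Qed.

Lemma tail_boxP (R : realType) (d : nat) (s : R) (h : {poly int}) :
  0 < s -> h \in tail_box d s -> [/\ h \is monic, size h = d.+1 &
    forall z, z \in zroots R h -> nc z < s].
Proof.
move=> s0 /monic_boxP[hm sh hh]; split=> //.
apply: (roots_lt_of_small_coef s0 hm sh) => i id'.
have /andP[h1 h2] := hh i id'; move: h2; set W := Num.truncn _ => h2.
have tw := tail_width_gt0 R d.
have W0 : W%:R <= tail_width R d * s ^+ (d - i).
  by rewrite truncn_le mulr_ge0 ?exprn_ge0 // ltW.
apply: (@le_trans _ _ W%:R); first by rewrite ler_nat; lia.
apply: (le_trans W0); rewrite ler_wpM2r ?exprn_ge0 ?(ltW s0) // /tail_width.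
rewrite lef_pV2 ?posrE ?ltr0n ?ler_nat; lia.
Qed.

Definition cell (R : realType) (m d : nat) (s : R) (A : int) (L : {poly int}) :=
  [seq L * reciprocal_lift A m Q * h | Q <- lift_box m s, h <- tail_box d s].

Section Cell.
Variables (R : realType) (l m d : nat) (s : R) (A : int) (L : {poly int}).
Hypotheses (s0 : 0 < s) (sA : s ^+ 2 = A%:~R) (Lm : L \is monic)
  (sL : size L = l.+1) (rL : forall z, z \in zroots R L -> nc z = s).

Lemma cell_perm (Q h : {poly int}) : Q \in lift_box m s -> h \in tail_box d s ->
  perm_eq (zroots R (L * reciprocal_lift A m Q * h))
    (zroots R (L * reciprocal_lift A m Q) ++ zroots R h) /\
  [/\ L * reciprocal_lift A m Q \is monic,
     size (zroots R (L * reciprocal_lift A m Q)) = (l + 2 * m)%N &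
   forall z, z \in zroots R (L * reciprocal_lift A m Q) -> nc z = s].
Proof.
move=> /(lift_boxP s0 sA)[Qm sQ Gm [zs [szs hzs zsE]]] /(tail_boxP s0)[hm sh hr].
have LGm : L * reciprocal_lift A m Q \is monic by rewrite monicMl.
have p1 := perm_zrootsM R LGm hm; have p2 := perm_zrootsM R Lm Gm.
have p3 := perm_zroots Gm zsE.
split=> //; split=> //.
  rewrite (perm_size p2) size_cat (perm_size p3) szs.
  by have := size_zroots R Lm; rewrite sL => -[<-].
by move=> z; rewrite (perm_mem p2) mem_cat (perm_mem p3) => /orP[/rL|/hzs].
Qed.

Lemma cell_uniq : uniq (cell m d s A L).
Proof.
apply: allpairs_uniq; rewrite ?monic_box_uniq //.
move=> [Q h] [Q' h'] /allpairsP[[Q1 h1] /= [QB hB [eQ eh]]].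
move=> /allpairsP[[Q1' h1'] /= [QB' hB' [eQ' eh']]] E; subst Q1 h1 Q1' h1'.
(* The roots of the last factor have modulus less than [s], so the roots of modulus [s] give back
   the product of [L] and the lift; then [Q] follows by injectivity of the lift, and [h] by
   cancellation. *)
have top (P g : {poly int}) : P \in lift_box m s -> g \in tail_box d s ->
    intpoly R (L * reciprocal_lift A m P) =
      rootpoly [seq z <- zroots R (L * reciprocal_lift A m P * g) | nc z == s].
  move=> PB gB; have [pm [LGm _ hr]] := cell_perm PB gB.
  have [_ _ gr] := tail_boxP s0 gB.
  rewrite intpolyE //; apply: perm_big; rewrite perm_sym.
  apply: (perm_trans (perm_filter _ pm)); rewrite filter_cat.
  have /all_filterP -> : all (fun z => nc z == s) (zroots R (L * reciprocal_lift A m P)).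
    by apply/allP => z /hr ->.
  have -> : [seq z <- zroots R g | nc z == s] = [::].
    by apply/eqP; rewrite -[_ == _]negbK -has_filter; apply/hasPn => z /gr/lt_eqF ->.
  by rewrite cats0.
have LQ : L * reciprocal_lift A m Q = L * reciprocal_lift A m Q'.
  by apply: (@intpoly_inj R); rewrite (top _ _ QB hB) (top _ _ QB' hB') E.
have [Qm sQ Gm _] := lift_boxP s0 sA QB; have [Qm' sQ' _ _] := lift_boxP s0 sA QB'.
have QQ : Q = Q'.
  apply: (@reciprocal_lift_inj _ A m); rewrite ?sQ ?sQ' //.
  by apply: mulfI LQ; apply: monic_neq0.
rewrite -QQ; congr (_, _); move: E; rewrite -QQ; apply: mulfI.
by apply: monic_neq0; rewrite monicMl.
Qed.

Lemma cell_maxnorm (f : {poly int}) : (0 < l + 2 * m)%N ->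
  f \in cell m d s A L -> maxnorm (zroots R f) = s.
Proof.
move=> lm0 /allpairsP[[Q h] /= [QB hB ->]].
have [pm [_ sz hr]] := cell_perm QB hB; have [_ _ gr] := tail_boxP s0 hB.
apply: maxnorm_eq => [|z].
  case E : (zroots _ _) sz hr => [|z zs] /= sz hr; first by rewrite -sz in lm0.
  exists z; last by apply: hr; rewrite mem_head.
  by rewrite (perm_mem pm) mem_cat E mem_head.
by rewrite (perm_mem pm) mem_cat => /orP[/hr->|/gr/ltW].
Qed.

(** The disjunction lists the two ways to split [f] into nonconstant factors: [L] against the rest,
    or [h] against the rest. All roots having modulus at most [s], the coefficients are at most 2^n
    s^n. *)
Lemma cell_reducible_set (n k H : nat) (f : {poly int}) :
  (0 < k)%N -> (k = l + 2 * m)%N -> (n = k + d)%N -> 1 <= s -> 2 ^+ n * s ^+ n <= H%:R ->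
  ((0 < l) && (0 < 2 * m + d) || (0 < m) && (0 < d))%N ->
  f \in cell m d s A L -> reducible_set R n k H f.
Proof.
move=> k0 kE nE s1 HB red fB.
have maxE : maxnorm (zroots R f) = s by apply: cell_maxnorm => //; rewrite -kE.
have /allpairsP[[Q h] /= [QB hB fE]] := fB.
have [pm [LGm sz hr]] := cell_perm QB hB; have [hm sh gr] := tail_boxP s0 hB.
have [_ _ Gm [zs [szs _ zsE]]] := lift_boxP s0 sA QB.
have sG : size (reciprocal_lift A m Q) = (2 * m).+1.
  by rewrite -(size_intpoly R) zsE size_prod_XsubC szs.
rewrite -fE in pm.
have fm : f \is monic by rewrite fE monicMl.
have sf : size f = n.+1.
  rewrite (size_zroots R fm) (perm_size pm) size_cat sz -kE nE.
  by have := size_zroots R hm; rewrite sh => -[<-].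
split=> //.
- apply: height_le => i; rewrite -(ler_nat R); apply: le_trans HB.
  apply: (le_trans (abscoef_le_pow (rho := s) i fm sf (ltW s0) _)).
    by move=> z zf; rewrite -maxE maxnorm_ge.
  by rewrite ler_wpM2l ?exprn_ge0 // ler_weXn2l // leq_subr.
- apply/(monic_reducibleP fm); case/orP: red => /andP[h1 h2].
    exists L, (reciprocal_lift A m Q * h); split=> //.
    + by rewrite monicMl.
    + by rewrite sL.
    + by rewrite size_monicM ?monic_neq0 // sG sh addSn addnS.
    + by rewrite fE mulrA.
  exists (L * reciprocal_lift A m Q), h; split=> //; last by rewrite sh.
  by rewrite size_monicM ?monic_neq0 // sL sG addSn addnS -kE.
rewrite nb_max_rootsE maxE (permP pm) count_cat.
have -> : count (fun z => nc z == s) (zroots R h) = 0%N.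
  by apply/eqP; rewrite -leqn0 leqNgt -has_count; apply/hasPn => z /gr/lt_eqF ->.
rewrite addn0 kE -sz; apply/eqP; rewrite -all_count.
by apply/allP => z /hr ->.
Qed.

Lemma size_cell : 1 <= s -> 2 <= lift_width R m * s -> 2 <= tail_width R d * s ->
  (lift_width R m / 2) ^+ m * (tail_width R d / 2) ^+ d *
    s ^+ ('C(m.+1, 2) + 'C(d.+1, 2)) <= (size (cell m d s A L))%:R.
Proof.
move=> s1 h1 h2; rewrite size_allpairs !size_monic_box natrM exprD mulrACA.
by apply: ler_pM;
  rewrite ?mulr_ge0 ?exprn_ge0 ?divr_ge0 ?(ltW s0) ?(ltW (lift_width_gt0 _ _))
    ?(ltW (tail_width_gt0 _ _)) ?staircase_widths ?lift_width_gt0 ?tail_width_gt0.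
Qed.
End Cell.

(** * Lower bounds *)

Lemma normcX (R : realType) (z : R[i]) (n : nat) : nc (z ^+ n) = nc z ^+ n :> R.
Proof. by elim: n => [|n IH]; rewrite ?expr0 ?nc1 // !exprS Normc.normcM IH. Qed.

Lemma zroots_horner (R : realType) (f : {poly int}) (z : R[i]) :
  f \is monic -> z \in zroots R f -> (intpoly R f).[z] = 0.
Proof.
by move=> fm zf; apply/eqP; rewrite -/(root _ z) intpolyE // root_prod_XsubC.
Qed.

(** The witness is x^(n-k) (x^k - 1) = x^n - x^(n-k): its nonzero roots are the [k]-th roots of
    unity, and x - 1 is a proper factor because n > 1. *)
Lemma Rcount_gt0 (R : realType) (n k H : nat) :
  (1 < n)%N -> (0 < k <= n)%N -> (0 < H)%N -> (0 < Rcount R n k H)%N.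
Proof.
move=> n1 /andP[k0 kn] H0.
pose g : {poly int} := 'X^(n - k); pose h : {poly int} := 'X^k - 1.
have gm : g \is monic by apply: monicXn.
have sh : size h = k.+1 by rewrite size_XnsubC.
have hm : h \is monic by apply: monicXnsubC.
have fm : g * h \is monic by rewrite monicMl.
have sf : size (g * h) = n.+1.
  by rewrite size_monicM ?monic_neq0 // size_polyXn sh; lia.
have fS : reducible_set R n k H (g * h).
  split=> //.
  - have -> : g * h = 'X^n - 'X^(n - k) by rewrite mulrBr mulr1 -exprD subnK.
    apply: height_le => i; rewrite coefB !coefXn; apply: leq_trans H0.
    by case: (i == n); case: (i == (n - k)%N).
  - apply/(monic_reducibleP fm).
    have hE : h = ('X - 1%:P) * \sum_(i < k) 'X^i by rewrite /h subrX1 polyC1.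
    have m1 : 'X - 1%:P \is @monic int by apply: monicXsubC.
    have m2 : \sum_(i < k) 'X^i \is @monic int by rewrite -(monicMl _ m1) -hE.
    have m3 : g * \sum_(i < k) 'X^i \is monic by rewrite monicMl.
    have fE : g * h = ('X - 1%:P) * (g * \sum_(i < k) 'X^i) by rewrite mulrCA -hE.
    exists ('X - 1%:P), (g * \sum_(i < k) 'X^i); split=> //.
      by rewrite size_XsubC.
    have := sf; rewrite fE size_monicM ?monic_neq0 // size_XsubC; lia.
  have pm := perm_zrootsM R gm hm.
  have gr z : z \in zroots R g -> nc z = 0.
    move=> /(zroots_horner gm); rewrite /intpoly map_polyXn hornerXn => /(congr1 (@Normc.normc R)).
    by rewrite normcX nc0 => /eqP; rewrite expf_eq0 => /andP[_ /eqP].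
  have hr z : z \in zroots R h -> nc z = 1.
    move=> /(zroots_horner hm); rewrite /intpoly rmorphB rmorph1 /= map_polyXn !hornerE.
    move=> /eqP; rewrite subr_eq0 => /eqP /(congr1 (@Normc.normc R)); rewrite normcX nc1 => /eqP.
    by rewrite pexpr_eq1 ?normc_ge0 // => /eqP.
  have szh : size (zroots R h) = k by have := size_zroots R hm; rewrite sh => -[].
  have maxE : maxnorm (zroots R (g * h)) = 1.
    apply: maxnorm_eq => [|z].
      case E : (zroots R h) szh hr => [|z zs] /= szh hr; first by rewrite -szh in k0.
      exists z; last by rewrite hr // mem_head.
      by rewrite (perm_mem pm) mem_cat E mem_head orbT.
    by rewrite (perm_mem pm) mem_cat => /orP[/gr->|/hr->].
  rewrite nb_max_rootsE maxE (permP pm) count_cat.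
  have -> : count (fun z => nc z == 1) (zroots R g) = 0%N.
    apply/eqP; rewrite -leqn0 leqNgt -has_count; apply/hasPn => z /gr ->.
    by rewrite eq_sym oner_eq0.
  rewrite add0n -[RHS]szh; apply/eqP; rewrite -all_count.
  by apply/allP => z /hr ->.
have := @Rcount_ge R n k H [:: g * h] isT; apply => f.
by rewrite inE => /eqP->.
Qed.

(** [beta] is 1 when A = t^2 and 1/2 when A = t. The integers t run over [N, 2 N) with N of order
    H^(1/(n beta)); each cell has at least a constant times N^(beta E) elements, and the cells are
    disjoint because t^beta is the maximal modulus of the roots. *)
Lemma equimodular_family_lower_bound (R : realType) (l m d n k : nat) (beta : R)
    (A : nat -> int) (L : nat -> {poly int}) :
  2^-1 <= beta -> (0 < k)%N -> (1 < n)%N ->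
  (k = l + 2 * m)%N -> (n = k + d)%N ->
  ((0 < l) && (0 < 2 * m + d) || (0 < m) && (0 < d))%N ->
  (forall t, (0 < t)%N -> [/\ (t%:R `^ beta) ^+ 2 = (A t)%:~R :> R, L t \is monic,
     size (L t) = l.+1 & forall z, z \in zroots R (L t) -> nc z = t%:R `^ beta]) ->
  let E := ('C(m.+1, 2) + 'C(d.+1, 2))%N in
  exists c : R, 0 < c /\ forall H : nat, (1 <= H)%N ->
    c * H%:R `^ ((1 + beta * E%:R) / (n%:R * beta)) <= (Rcount R n k H)%:R.
Proof.
move=> beta2 k0 n1 kE nE red hL E.
have beta0 : 0 < beta by apply: lt_le_trans beta2; rewrite invr_gt0.
have n0R : 0 < n%:R :> R by rewrite ltr0n ltnW.
have lw := lift_width_gt0 R m; have tw := tail_width_gt0 R d.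
pose w : R := 1 + beta * E%:R.
have w0 : 0 <= w by rewrite addr_ge0 // mulr_ge0 // ltW.
pose c1 : R := (lift_width R m / 2) ^+ m * (tail_width R d / 2) ^+ d.
have c10 : 0 < c1 by rewrite mulr_gt0 // exprn_gt0 // divr_gt0.
pose s0 : R := Num.max 1 (Num.max (2 / lift_width R m) (2 / tail_width R d)).
have s01 : 1 <= s0 by rewrite le_max lexx.
(* For x >= x0 this yields N >= s0^2, so that t^beta >= s0 for all t >= N because beta >= 1/2; it
   also yields N >= x / 16. *)
pose x0 : R := 8 * (s0 ^+ 2 + 1).
have x00 : 0 < x0 by rewrite /x0; have := sqr_ge0 s0; lra.
pose c : R := Num.min (c1 * 16 `^ (- w)) (x0 `^ (- w)).
have c0 : 0 < c by rewrite lt_min mulr_gt0 ?powR_gt0.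
exists c; split=> // H H1.
pose x : R := H%:R `^ (n%:R * beta)^-1.
have xge0 : 0 <= x by apply: powR_ge0.
have xw : H%:R `^ (w / (n%:R * beta)) = x `^ w by rewrite /x -powRrM mulrC.
rewrite -/w xw.
(* For small [H] the boxes may be empty, and the single polynomial of [Rcount_gt0] is enough. *)
have [xx0|x0x] := ltP x x0.
  apply: (@le_trans _ _ 1); last by rewrite ler1n Rcount_gt0 // k0 nE leq_addr.
  apply: (@le_trans _ _ (x0 `^ (- w) * x0 `^ w)).
    apply: ler_pM; rewrite ?powR_ge0 ?(ltW c0) ?ge_min ?lexx ?orbT //.
    by apply: ge0_ler_powR; rewrite ?nnegrE ?(ltW xx0) ?(ltW x00).
  by rewrite powRN mulVf // gt_eqF // powR_gt0.
pose N := Num.truncn (x / 8).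
have xN : x / 8 < N%:R + 1 by rewrite natr1 truncnS_gt.
have Nx : N%:R <= x / 8 by rewrite truncn_le divr_ge0.
have sq0 : s0 <= s0 ^+ 2 by rewrite ler_eXnr.
have Nbig : s0 ^+ 2 <= N%:R by rewrite /x0 in x0x; lra.
have N16 : x / 16 <= N%:R by rewrite /x0 in x0x; lra.
have N1R : 1 <= N%:R :> R by lra.
have N1 : (0 < N)%N by rewrite -(ler1n R).
pose F t := cell m d (t%:R `^ beta : R) (A t) (L t).
have bigs t : (N <= t)%N -> s0 <= t%:R `^ beta.
  move=> Nt; apply: (@le_trans _ _ ((s0 ^+ 2) `^ 2^-1)).
    by rewrite powR12_sqrt ?sqr_ge0 // sqrtr_sqr ler_norm.
  apply: (@le_trans _ _ ((s0 ^+ 2) `^ beta)).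
    by apply: ler_powR => //; lra.
  apply: ge0_ler_powR; rewrite ?nnegrE ?sqr_ge0 ?(ltW beta0) //.
  by apply: (le_trans Nbig); rewrite ler_nat.
pose r := iota N N.
have rP t : t \in r -> (N <= t < N + N)%N by rewrite mem_iota.
have hF t : t \in r -> forall f, f \in F t ->
    reducible_set R n k H f /\ maxnorm (zroots R f) = t%:R `^ beta.
  move=> /rP /andP[Nt tN] f fF.
  have t0 : (0 < t)%N by apply: leq_trans Nt.
  have [sA Lm sL rL] := hL t t0.
  have s1 : 1 <= t%:R `^ beta :> R by apply: le_trans (bigs t Nt).
  have spos : 0 < t%:R `^ beta :> R by apply: lt_le_trans s1.
  split; last by apply: (cell_maxnorm spos sA Lm sL rL) fF; rewrite -kE.
  apply: (cell_reducible_set spos sA Lm sL rL k0 kE nE s1 _ red fF).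
  rewrite -exprMn.
  have tx : t%:R <= x / 4.
    have : t%:R <= (N + N)%:R :> R by rewrite ler_nat ltnW.
    rewrite natrD; lra.
  have four : 4 `^ 2^-1 = 2 :> R.
    have -> : 4 = 2 ^+ 2 :> R by rewrite -natrX.
    by rewrite powR12_sqrt ?sqr_ge0 // sqrtr_sqr ger0_norm.
  (* This is the height condition 2^n s^n <= H, as [H] is the n-th power of x^beta; it follows from
     t <= x / 4 because 4^beta >= 2. *)
  have h1 : 2 * t%:R `^ beta <= x `^ beta.
    apply: (@le_trans _ _ (4 `^ beta * t%:R `^ beta)).
      by rewrite ler_wpM2r ?powR_ge0 // -four ler_powR //; lra.
    rewrite -powRM //; apply: ge0_ler_powR; rewrite ?nnegrE ?mulr_ge0 ?(ltW beta0) //.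
    by rewrite mulrC -ler_pdivlMr.
  apply: (@le_trans _ _ ((x `^ beta) ^+ n)).
    by rewrite lerXn2r ?nnegrE ?mulr_ge0 ?powR_ge0.
  rewrite -powR_mulrn ?powR_ge0 // /x -!powRrM.
  rewrite [beta * _]mulrC mulVf ?gt_eqF ?mulr_gt0 //.
  by rewrite powRr1.
have uniqF : uniq (flatten [seq F t | t <- r]).
  apply: uniq_flatten_disjoint; first exact: iota_uniq.
    move=> t /rP /andP[Nt tN].
    have t0 : (0 < t)%N by apply: leq_trans Nt.
    have [sA Lm sL rL] := hL t t0.
    by apply: (cell_uniq m d _ sA Lm sL rL); apply: powR_gt0; rewrite ltr0n.
  move=> t t' f tr tr' /(hF t tr)[_ h1] /(hF t' tr')[_ h2].
  apply/eqP; rewrite -(eqr_nat R); apply/eqP.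
  by apply: (@powR_injective R beta) => //; rewrite ?nnegrE // -h1 -h2.
have memF f : f \in flatten [seq F t | t <- r] -> reducible_set R n k H f.
  by move=> /flattenP[_ /mapP[t tr ->]] fF; have [] := hF t tr f fF.
apply: (@le_trans _ _ (size (flatten [seq F t | t <- r]))%:R); last first.
  by rewrite ler_nat; apply: Rcount_ge.
have sizeF t : t \in r -> c1 * (N%:R `^ beta) ^+ E <= (size (F t))%:R.
  move=> /rP /andP[Nt tN]; have t0 : (0 < t)%N by apply: leq_trans Nt.
  have st := bigs t Nt.
  have s1 : 1 <= t%:R `^ beta :> R by apply: le_trans st.
  apply: (@le_trans _ _ (c1 * (t%:R `^ beta) ^+ E)).
    rewrite ler_wpM2l ?(ltW c10) // lerXn2r ?nnegrE ?powR_ge0 //.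
    by apply: ge0_ler_powR; rewrite ?nnegrE ?(ltW beta0) // ler_nat.
  apply: size_cell => //; first by apply: lt_le_trans s1.
    rewrite mulrC -ler_pdivrMr //; apply: le_trans st.
    by rewrite !le_max lexx !orbT.
  rewrite mulrC -ler_pdivrMr //; apply: le_trans st.
  by rewrite !le_max lexx !orbT.
have sizeS : N%:R * (c1 * (N%:R `^ beta) ^+ E) <= (size (flatten [seq F t | t <- r]))%:R.
  rewrite size_flatten /shape -map_comp sumnE big_map natr_sum.
  apply: (@le_trans _ _ (\sum_(t <- r) (c1 * (N%:R `^ beta) ^+ E))).
    by rewrite big_const_seq count_predT size_iota iter_addr addr0 mulr_natl.
  by rewrite big_seq [leRHS]big_seq; apply: ler_sum => t tr; apply: sizeF.
apply: le_trans sizeS.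
have -> : N%:R * (c1 * (N%:R `^ beta) ^+ E) = c1 * N%:R `^ w.
  have N0 : N%:R != 0 :> R by rewrite pnatr_eq0 -lt0n.
  rewrite /w powRD ?N0 ?implybT //.
  by rewrite powRr1 // powRrM powR_mulrn ?powR_ge0 // mulrCA.
apply: (@le_trans _ _ (c1 * 16 `^ (- w) * x `^ w)).
  by rewrite ler_wpM2r ?powR_ge0 // ge_min lexx.
rewrite -mulrA ler_wpM2l ?(ltW c10) // powRN -ler_pdivlMl ?invr_gt0 ?powR_gt0 // invrK.
rewrite -powRM //; apply: ge0_ler_powR; rewrite ?nnegrE ?mulr_ge0 //.
lra.
Qed.

Lemma bin2_natr (R : realType) (m : nat) :
  'C(m.+1, 2)%:R = (m%:R + 1) * m%:R / 2 :> R.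
Proof.
have : (2 * 'C(m.+1, 2))%N%:R = (m.+1 * m)%N%:R :> R by rewrite doublebin2.
by rewrite !natrM -[m.+1%:R]natr1 => h; lra.
Qed.

(** The factor x - t alone makes f reducible, since n >= 3 leaves a nonconstant cofactor; hence k =
    n is allowed. *)
Lemma lower_bound_odd (R : realType) (n k : nat) :
  (3 <= n)%N -> (1 <= k <= n)%N -> odd k ->
  exists c' : R, 0 < c' /\ forall H : nat, (1 <= H)%N ->
    c' * (H%:R `^ e_exp R n k) <= (Rcount R n k H)%:R.
Proof.
move=> n3 /andP[k1 kn] ko.
pose m := k./2; pose d := (n - k)%N.
have kE : k = (1 + 2 * m)%N by rewrite /m mul2n -{1}(odd_double_half k) ko.
have nE : n = (k + d)%N by rewrite subnKC.
have [|||t t0|c [c0 hc]] := @equimodular_family_lower_bound R 1 m d n k 1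
  (fun t => (t ^ 2)%N%:Z) (fun t => 'X - t%:Z%:P) _ k1 _ kE nE.
- lra.
- exact: leq_trans n3.
- rewrite -ltnS; move: n3; rewrite nE kE; lia.
- rewrite !powRr1 //; split=> //.
  + by rewrite -natrX.
  + by rewrite monicXsubC.
  + by rewrite size_XsubC.
  move=> z /(zroots_horner (monicXsubC _)).
  rewrite /intpoly map_polyXsubC hornerXsubC => /eqP; rewrite subr_eq0 => /eqP ->.
  by rewrite normc_int.
exists c; split=> // H H1.
have -> : e_exp R n k = (1 + 1 * ('C(m.+1, 2) + 'C(d.+1, 2))%N%:R) / (n%:R * 1).
  rewrite /e_exp ko natrD !bin2_natr.
  have -> : n%:R = k%:R + d%:R :> R by rewrite nE natrD.
  have kR : k%:R = 1 + 2 * m%:R :> R by rewrite {1}kE natrD natrM.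
  rewrite kR; field; rewrite -kR -natrD -nE pnatr_eq0; lia.
exact: hc.
Qed.

(** With L = 1, reducibility comes from [h], which is not constant because k < n. *)
Lemma lower_bound_even (R : realType) (n k : nat) :
  (3 <= n)%N -> (1 <= k <= n)%N -> ~~ odd k -> (k < n)%N ->
  exists c' : R, 0 < c' /\ forall H : nat, (1 <= H)%N ->
    c' * (H%:R `^ e_exp R n k) <= (Rcount R n k H)%:R.
Proof.
move=> n3 /andP[k1 kn] ke kltn.
pose m := k./2; pose d := (n - k)%N.
have kE : k = (0 + 2 * m)%N by rewrite add0n /m mul2n -{1}(odd_double_half k) (negPf ke).
have nE : n = (k + d)%N by rewrite subnKC.
have [|||t t0|c [c0 hc]] := @equimodular_family_lower_bound R 0 m d n k 2^-1
  (fun t => t%:Z) (fun t => 1) _ k1 _ kE nE.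
- by [].
- exact: leq_trans n3.
- by rewrite /d subn_gt0 kltn andbT; move: k1; rewrite {1}kE; lia.
- rewrite powR12_sqrt // sqr_sqrtr //; split=> //.
  + exact: monic1.
  + exact: size_poly1.
  move=> z; have := size_zroots R (monic1 int); rewrite size_poly1.
  by case: (zroots R 1).
exists c; split=> // H H1.
have -> : e_exp R n k = (1 + 2^-1 * ('C(m.+1, 2) + 'C(d.+1, 2))%N%:R) / (n%:R * 2^-1).
  rewrite /e_exp (negPf ke) natrD !bin2_natr.
  have -> : n%:R = k%:R + d%:R :> R by rewrite nE natrD.
  have kR : k%:R = 2 * m%:R :> R by rewrite {1}kE natrM.
  rewrite kR; field; rewrite -kR -natrD -nE pnatr_eq0; lia.
exact: hc.
Qed.

(** Here d = 0 and m = n/2 - 1, which is positive because an even n >= 3 is at least 4. *)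
Lemma lower_bound_full_even (R : realType) (n : nat) : (3 <= n)%N -> ~~ odd n ->
  exists c'' : R, 0 < c'' /\ forall H : nat, (1 <= H)%N ->
    c'' * (H%:R `^ (n%:R / 8 + 2 / n%:R - 1 / 4)) <= (Rcount R n n H)%:R.
Proof.
move=> n3 ne; pose m := n./2.-1.
have mE : n./2 = m.+1 by rewrite /m prednK // half_gt0 ltnW.
have nE : n = (2 + 2 * m)%N.
  by rewrite -{1}(odd_double_half n) (negPf ne) mE -mul2n add0n mulnS.
have [||||t t0|c [c0 hc]] := @equimodular_family_lower_bound R 2 m 0 n n 2^-1
  (fun t => t%:Z) (fun t => 'X^2 - t%:Z%:P) _ _ _ nE (esym (addn0 n)).
- by [].
- exact: leq_trans n3.
- exact: leq_trans n3.
- by move: n3; rewrite nE; lia.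
- have Lm : 'X^2 - t%:Z%:P \is monic by apply: monicXnsubC.
  rewrite powR12_sqrt // sqr_sqrtr //; split=> //.
    by rewrite size_XnsubC.
  move=> z /(zroots_horner Lm).
  rewrite /intpoly rmorphB /= map_polyXn map_polyC /= !hornerE => /eqP.
  rewrite subr_eq0 => /eqP /(congr1 (@Normc.normc R)); rewrite normcX normc_int /= => h.
  by rewrite -h sqrtr_sqr ger0_norm ?normc_ge0.
exists c; split=> // H H1.
have -> : n%:R / 8 + 2 / n%:R - 1 / 4 =
    (1 + 2^-1 * ('C(m.+1, 2) + 'C(1, 2))%N%:R) / (n%:R * 2^-1) :> R.
  rewrite addn0 bin2_natr.
  have nR : n%:R = 2 + 2 * m%:R :> R by rewrite {1}nE natrD natrM.
  rewrite nR; field; rewrite -nR pnatr_eq0; lia.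
exact: hc.
Qed.

(** * Quadratic polynomials *)

Definition int_pair_poly (a b : int) : {poly int} := ('X - a%:P) * ('X - b%:P).

Lemma int_pair_polyE (a b : int) :
  int_pair_poly a b = 'X^2 - (a + b) *: 'X + (a * b)%:P.
Proof. by rewrite /int_pair_poly -mul_polyC polyCD polyCM; ring. Qed.

Lemma nb_max_roots_int_pair (R : realType) (a b : int) :
  nb_max_roots (intpoly R (int_pair_poly a b)) = if (`|a| == `|b|)%N then 2%N else 1%N.
Proof.
have rE : intpoly R (int_pair_poly a b) = rootpoly [:: a%:~R; b%:~R].
  by rewrite /intpoly rmorphM /= !map_polyXsubC /rootpoly !big_cons big_nil mulr1.
have fm : int_pair_poly a b \is monic by rewrite monicMl monicXsubC.
have pm := perm_zroots fm rE.
have -> : nb_max_roots (intpoly R (int_pair_poly a b)) =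
    count (fun z => nc z == maxnorm (zroots R (int_pair_poly a b))) (zroots R (int_pair_poly a b)) by [].
have -> : maxnorm (zroots R (int_pair_poly a b)) = (maxn `|a| `|b|)%:R.
  apply: maxnorm_eq => [|z].
    case: (leqP `|a| `|b|) => _; [exists b%:~R|exists a%:~R];
      by rewrite ?normc_int // (perm_mem pm) !inE eqxx ?orbT.
  rewrite (perm_mem pm) !inE => /orP[]/eqP->; rewrite normc_int ler_nat.
    by rewrite leq_maxl.
  by rewrite leq_maxr.
rewrite (permP pm) /= !normc_int !eqr_nat addn0.
by case: (ltngtP `|a| `|b|) => [h|h|->]; rewrite ?eqxx ?(ltn_eqF h).
Qed.

Lemma monic_size2 (g : {poly int}) : g \is monic -> size g = 2%N ->
  g = 'X - (- g`_0)%:P.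
Proof.
move=> gm sg; apply/polyP => i; rewrite coefB coefX coefC; case: i => [|[|i]] /=.
- by rewrite sub0r opprK.
- by rewrite subr0; have := monicP gm; rewrite lead_coefE sg.
- by rewrite subr0 nth_default // sg.
Qed.

Lemma reducible_set2P (R : realType) (k H : nat) (f : {poly int}) :
  reducible_set R 2 k H f -> exists a b : int, [/\ f = int_pair_poly a b,
    (`|(a + b)%R| <= H)%N, (`|(a * b)%R| <= H)%N & k = if (`|a| == `|b|)%N then 2%N else 1%N].
Proof.
move=> [fm sf hf /(monic_reducibleP fm)[g [h [gm hm sg sh fE]]] kf].
have : (size f = (size g + size h).-1)%N by rewrite fE size_monicM ?monic_neq0.
rewrite sf => sE; have sg2 : size g = 2%N by lia.
have sh2 : size h = 2%N by lia.
exists (- g`_0), (- h`_0).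
have fP : f = int_pair_poly (- g`_0) (- h`_0) by rewrite fE /int_pair_poly -!monic_size2.
split=> //; last by rewrite -kf -(nb_max_roots_int_pair R) -fP.
  have := abscoef_le_height f 1; rewrite {1}fP int_pair_polyE !coefE /=.
  by rewrite mulr1 addr0 sub0r abszN => h1; apply: leq_trans h1 hf.
have := abscoef_le_height f 0; rewrite {1}fP int_pair_polyE !coefE /=.
by rewrite mulr0 subr0 add0r => h1; apply: leq_trans h1 hf.
Qed.

Lemma int_pair_reducible_set (R : realType) (H : nat) (a b : int) :
  (0 < H)%N -> (`|(a + b)%R| <= H)%N -> (`|(a * b)%R| <= H)%N ->
  reducible_set R 2 (if (`|a| == `|b|)%N then 2%N else 1%N) H (int_pair_poly a b).
Proof.
move=> H0 h1 h2; have fm : int_pair_poly a b \is monic by rewrite monicMl monicXsubC.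
split=> //; last exact: nb_max_roots_int_pair.
- by rewrite size_monicM ?monicXsubC ?polyXsubC_eq0 // !size_XsubC.
- apply: height_le => i; rewrite int_pair_polyE coefD coefB coefXn coefZ coefX coefC.
  by case: i => [|[|[|i]]] //=; lia.
apply/(monic_reducibleP fm); exists ('X - a%:P), ('X - b%:P).
by rewrite !monicXsubC !size_XsubC.
Qed.

Lemma harmonic_le (R : realType) (m : nat) :
  \sum_(j < m.+1) (j.+1%:R)^-1 <= 1 + ln m.+1%:R :> R.
Proof.
elim: m => [|m IH]; first by rewrite big_ord1 ln1 addr0 invr1.
rewrite big_ord_recr /=; apply: (le_trans (lerD IH (lexx _))).
rewrite -addrA lerD2l -lerBrDl.
have h := @le_ln1Dx R (- (m.+2%:R)^-1).
have E : 1 + - (m.+2%:R)^-1 = m.+1%:R / m.+2%:R :> R.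
  have x0 : 0 < m.+1%:R :> R by rewrite ltr0n.
  by rewrite -[m.+2%:R]natr1; move: m.+1%:R x0 => x x0; field; rewrite gt_eqF //; lra.
rewrite E ln_div ?posrE ?ltr0n // in h.
have lt : -1 < - (m.+2%:R)^-1 :> R by rewrite ltrN2 invf_lt1 ?ltr0n // ltr1n.
by rewrite -lerN2 opprB; apply: h.
Qed.

Lemma harmonic_ge (R : realType) (m : nat) :
  ln m.+1%:R <= \sum_(j < m) (j.+1%:R)^-1 :> R.
Proof.
elim: m => [|m IH]; first by rewrite big_ord0 ln1.
rewrite big_ord_recr /=; apply: (le_trans _ (lerD IH (lexx _))).
rewrite -lerBlDl.
have h := @le_ln1Dx R (m.+1%:R)^-1.
have E : 1 + (m.+1%:R)^-1 = m.+2%:R / m.+1%:R :> R.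
  have x0 : 0 < m.+1%:R :> R by rewrite ltr0n.
  by rewrite -[m.+2%:R]natr1; move: m.+1%:R x0 => x x0; field; rewrite gt_eqF.
rewrite E ln_div ?posrE ?ltr0n // in h; apply: h.
by apply: lt_trans (_ : 0 < _); rewrite ?invr_gt0 ?ltr0n // oppr_lt0.
Qed.

(** The root of larger modulus is [j + 1] up to sign, and the other one is at most H / (j + 1) in
    absolute value. The factor 6 is 2 for the sign times the 3 of [covered_int_le]. *)
Lemma Rcount21_upper (R : realType) (H : nat) : (2 <= H)%N ->
  (Rcount R 2 1 H)%:R <= 6 * ((ln 2)^-1 + 1) * (H%:R * ln H%:R) :> R.
Proof.
move=> H2; have H0 : 0 < H%:R :> R by rewrite ltr0n ltnW.
pose js := index_iota 0 H.
pose S (j : nat) (f : {poly int}) := exists b : int,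
   `|b|%N%:R <= H%:R / j.+1%:R :> R /\
   (f = int_pair_poly (Posz j.+1) b \/ f = int_pair_poly (- Posz j.+1) b).
apply: Rcount_le; apply: (@covered_sub _ _ _ (fun f => exists2 j, j \in js & S j f)
  (\sum_(j <- js) (6 * (H%:R / j.+1%:R)))).
- move=> f /reducible_set2P[a0 [b0 [fE0 sH0 pH0 ab0]]].
  have [a [b [fE sH pH ab]]] : exists a b : int, [/\ f = int_pair_poly a b,
      (`|(a + b)%R| <= H)%N, (`|(a * b)%R| <= H)%N & (`|b| < `|a|)%N].
    case: (ltngtP `|a0| `|b0|) ab0 => [ab _|ab _|//]; last by exists a0, b0.
    by exists b0, a0; rewrite fE0 /int_pair_poly; split; rewrite // 1?mulrC // addrC.
  have a0' : (0 < `|a|)%N by apply: leq_ltn_trans ab.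
  have aH : (`|a| <= H)%N.
    (* For b = 0 the product says nothing about [a], and the sum of the roots bounds it instead. *)
    have [bE|bN] := eqVneq b 0; first by rewrite bE addr0 in sH.
    by apply: leq_trans pH; rewrite abszM leq_pmulr // absz_gt0.
  exists `|a|.-1; first by rewrite mem_index_iota prednK.
  exists b; rewrite prednK //; split.
    rewrite ler_pdivlMr ?ltr0n // -natrM ler_nat mulnC -abszM //.
  case: (intP a) fE a0' => [|n|n] fE // _; [left|right]; rewrite fE //.
- apply: covered_bigcup => j; rewrite mem_index_iota => /andP[_ jH].
  have u1 : 1 <= H%:R / j.+1%:R :> R by rewrite ler_pdivlMr ?ltr0n // mul1r ler_nat.
  have [s hs sx] := covered_int_le u1.
  exists ([seq int_pair_poly (Posz j.+1) b | b <- s] ++ [seq int_pair_poly (- Posz j.+1) b | b <- s]).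
    by move=> f [b [/hs bs [->|->]]]; rewrite mem_cat map_f ?orbT.
  by rewrite size_cat !size_map natrD; move: (size s)%:R (H%:R / _) sx => x u; lra.
rewrite -!mulr_sumr big_mkord mulrA.
case: H H2 H0 {js S} => [//|m] H2 H0; have h := harmonic_le R m.
have l2 : 0 < ln 2 :> R by rewrite ln_gt0 // ltr1n.
have lH : ln 2 <= ln m.+1%:R :> R by rewrite ler_ln ?posrE ?ltr0n // ler_nat.
(* This absorbs the summand 1 of [harmonic_le], thanks to 2 <= H. *)
have h1 : 1 <= (ln 2)^-1 * ln m.+1%:R :> R by rewrite mulrC ler_pdivlMr // mul1r.
rewrite -[leRHS]mulrA -[leLHS]mulrA ler_wpM2l // mulrCA ler_wpM2l ?(ltW H0) //.
by apply: (le_trans h); rewrite mulrDl mul1r lerD2r.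
Qed.

(** [a] is the only positive root of the first polynomial, and [c] that of the second. *)
Lemma int_pair_poly_inj (a b c d : nat) : (0 < a)%N -> (0 < c)%N ->
  int_pair_poly (Posz a) (- Posz b) = int_pair_poly (Posz c) (- Posz d) -> a = c /\ b = d.
Proof.
move=> a0 c0 E; have := congr1 (fun p => p.[Posz a]) E.
rewrite /int_pair_poly !hornerM !hornerXsubC subrr mul0r => /esym/eqP.
rewrite mulf_eq0 !subr_eq0 => /orP[/eqP[ac]|]; last by lia.
have := congr1 (fun p : {poly int} => p`_1) E; rewrite !int_pair_polyE !coefE /= ac.
by split=> //; lia.
Qed.

(** Pairs of positive integers with product at most [H] are counted, as roots a and -b: opposite
    signs keep the linear coefficient at most max(a, b) <= H. *)
Lemma Rcount21_lower (R : realType) (H : nat) : (2 <= H)%N ->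
  2^-1 * (H%:R * ln H%:R) <= (Rcount R 2 1 H)%:R :> R.
Proof.
move=> H2.
(* The excluded pair [a = b] is replaced by the polynomial [(x - a) x]. *)
pose F (b : nat) (a : nat) := int_pair_poly (Posz a) (- Posz (if a == b then 0 else b)).
pose s := flatten [seq [seq F b a | a <- iota 1 (H %/ b)] | b <- iota 1 H].
have Finj b a b' a' : (0 < b)%N -> (0 < b')%N -> (0 < a)%N -> (0 < a')%N ->
    F b a = F b' a' -> a = a' /\ b = b'.
  move=> b0 b0' a0 a0' /int_pair_poly_inj[] // -> h; split=> //.
  by move: h; case: eqP; case: eqP; lia.
have us : uniq s.
  apply: uniq_flatten_disjoint; first exact: iota_uniq.
    move=> b; rewrite mem_iota => /andP[b0 _]; rewrite map_inj_in_uniq ?iota_uniq //.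
    move=> a a'; rewrite !mem_iota => /andP[a0 _] /andP[a0' _] E.
    by have [] := Finj b a b a' b0 b0 a0 a0' E.
  move=> b b' f; rewrite !mem_iota => /andP[b0 _] /andP[b0' _].
  move=> /mapP[a + ->] /mapP[a' +]; rewrite !mem_iota => /andP[a0 _] /andP[a0' _] E.
  by have [] := Finj b a b' a' b0 b0' a0 a0' E.
have hs f : f \in s -> reducible_set R 2 1 H f.
  move=> /flattenP[_ /mapP[b + ->] /mapP[a + ->]]; rewrite !mem_iota.
  move=> /andP[b0 bH] /andP[a0 aH].
  have abH : (a * b <= H)%N by rewrite -leq_divRL // -ltnS -add1n.
  have aleH : (a <= H)%N by apply: leq_trans abH; rewrite leq_pmulr.
  rewrite /F; set b' := if _ then _ else _.
  have b'b : (b' <= b)%N by rewrite /b'; case: ifP.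
  have ab' : (a != b')%N by rewrite /b'; case: (eqVneq a b) => [_|//]; rewrite -lt0n.
  have ab'H : (a * b' <= H)%N by apply: leq_trans abH; rewrite leq_mul2l b'b orbT.
  have := @int_pair_reducible_set R H (Posz a) (- Posz b') (ltnW H2).
  rewrite abszN !absz_nat (negPf ab'); apply; last by rewrite abszM abszN.
  by move: bH; rewrite add1n ltnS => bH; lia.
apply: (@le_trans _ _ (size s)%:R); last by rewrite ler_nat Rcount_ge.
rewrite size_flatten /shape -map_comp sumnE big_map natr_sum.
rewrite (eq_bigr (fun b => (H %/ b)%N%:R)); last by move=> b _ /=; rewrite size_map size_iota.
apply: (@le_trans _ _ (2^-1 * (H%:R * ln H.+1%:R))).
  rewrite ler_wpM2l // ler_wpM2l // ler_ln ?posrE ?ltr0n ?ler_nat //; exact: ltnW.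
apply: (@le_trans _ _ (2^-1 * (H%:R * \sum_(j < H) (j.+1%:R)^-1))).
  by rewrite ler_wpM2l // ler_wpM2l // harmonic_ge.
have -> : iota 1 H = index_iota 1 H.+1 by rewrite /index_iota subn1.
rewrite big_add1 /= big_mkord mulr_sumr mulr_sumr; apply: ler_sum => j _.
have j0 : 0 < j.+1%:R :> R by rewrite ltr0n.
(* A quotient that is at least 1 loses at most half of its value when rounded down, whence the
   constant 1/2. *)
have h1 : (1 <= H %/ j.+1)%N by rewrite divn_gt0.
have h2 : H%:R <= ((H %/ j.+1) * j.+1 + j.+1)%N%:R :> R.
  by rewrite ler_nat {1}(divn_eq H j.+1) leq_add2l ltnW // ltn_mod.
rewrite mulrA ler_pdivrMr // mulrC ler_pdivrMr //.
apply: (le_trans h2); rewrite natrD natrM.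
have h3 : 1 <= (H %/ j.+1)%N%:R :> R by rewrite ler1n.
nra.
Qed.

Lemma Rcount22_upper (R : realType) (H : nat) : (1 <= H)%N ->
  (Rcount R 2 2 H)%:R <= 6 * H%:R `^ (1 / 2) :> R.
Proof.
move=> H1; rewrite div1r powR12_sqrt //.
have s1 : 1 <= Num.sqrt H%:R :> R by rewrite -[leLHS]sqrtr1 ler_sqrt ?ltr0n // ler1n.
have [s hs sx] := covered_int_le s1.
apply: Rcount_le.
exists ([seq int_pair_poly a a | a <- s] ++ [seq int_pair_poly a (- a) | a <- s]).
  move=> f /reducible_set2P[a [b [-> _ pH]]]; case: eqP => // ab _.
  have /hs as_ : `|a|%N%:R <= Num.sqrt H%:R :> R.
    rewrite -(@ler_pXn2r R 2) ?nnegrE ?sqrtr_ge0 // sqr_sqrtr // -natrX ler_nat.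
    by move: pH; rewrite abszM -ab mulnn.
  have [->|->] : b = a \/ b = - a by lia.
    by rewrite mem_cat (map_f (fun a => int_pair_poly a a)).
  by rewrite mem_cat (map_f (fun a => int_pair_poly a (- a))) ?orbT.
by rewrite size_cat !size_map natrD; lra.
Qed.

Lemma Rcount22_lower (R : realType) (H : nat) : (1 <= H)%N ->
  H%:R `^ (1 / 2) <= (Rcount R 2 2 H)%:R :> R.
Proof.
move=> H1; rewrite div1r powR12_sqrt //.
pose m := Num.truncn (Num.sqrt H%:R : R).
(* The value a = 0 counts, as x^2 has two roots of maximal modulus 0; it brings the total to m + 1,
   which exceeds the square root of [H]. *)
pose s := [seq int_pair_poly (Posz a) (- Posz a) | a <- iota 0 m.+1].
have us : uniq s.
  rewrite map_inj_in_uniq ?iota_uniq // => a b _ _.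
  rewrite !int_pair_polyE => /(congr1 (fun p : {poly int} => p`_0)).
  rewrite !coefE /= !mulrN => h.
  have h' : (a * a = b * b)%N by lia.
  by apply/eqP; rewrite -eqn_sqr -!mulnn h'.
have hs f : f \in s -> reducible_set R 2 2 H f.
  move=> /mapP[a + ->]; rewrite mem_iota add0n ltnS => /andP[_ am].
  have aH : (a ^ 2 <= H)%N.
    rewrite -(ler_nat R) natrX -[H%:R]sqr_sqrtr // lerXn2r ?nnegrE ?sqrtr_ge0 //.
    by rewrite -truncn_ge_nat ?sqrtr_ge0.
  have := @int_pair_reducible_set R H (Posz a) (- Posz a) H1.
  rewrite abszN eqxx; apply; first by rewrite subrr.
  by rewrite abszM abszN mulnn.
have := Rcount_ge us hs; rewrite size_map size_iota -(ler_nat R); apply: le_trans.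
exact: ltW (truncnS_gt _).
Qed.

Unset Implicit Arguments.

Theorem theorem1p3 (R : realType) :
  [/\ exists c1 c2 : R,
        [/\ 0 < c1, 0 < c2,
            forall H : nat, (2 <= H)%N ->
              c1 * (H%:R * ln H%:R) <= (Rcount R 2 1 H)%:R
                <= c2 * (H%:R * ln H%:R)
          & forall H : nat, (1 <= H)%N ->
              c1 * (H%:R `^ (1 / 2)) <= (Rcount R 2 2 H)%:R
                <= c2 * (H%:R `^ (1 / 2))],
      forall n k : nat, (3 <= n)%N -> (1 <= k <= n)%N ->
        exists c : R, 0 < c /\
          forall H : nat, (1 <= H)%N ->
            (Rcount R n k H)%:R <= c * (H%:R `^ (n%:R - (k%:R + 1) / 2)),
      forall n k : nat, (3 <= n)%N -> (1 <= k <= n)%N ->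
        ~ (k = n /\ ~~ odd k) ->
        exists c' : R, 0 < c' /\
          forall H : nat, (1 <= H)%N ->
            c' * (H%:R `^ e_exp R n k) <= (Rcount R n k H)%:R
    & forall n : nat, (3 <= n)%N -> ~~ odd n ->
        exists c'' : R, 0 < c'' /\
          forall H : nat, (1 <= H)%N ->
            c'' * (H%:R `^ (n%:R / 8 + 2 / n%:R - 1 / 4))
              <= (Rcount R n n H)%:R].
Proof.
split.
- have l2 : 0 < ln 2 :> R by rewrite ln_gt0 // ltr1n.
  have c2 : 6 <= 6 * ((ln 2)^-1 + 1) :> R.
    by rewrite ler_peMr // lerDr invr_ge0 ltW.
  exists 2^-1, (6 * ((ln 2)^-1 + 1)); split=> [||H H2|H H1].
  + by rewrite invr_gt0.
  + exact: lt_le_trans c2.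
  + by rewrite Rcount21_lower // Rcount21_upper.
  apply/andP; split.
    apply: le_trans (Rcount22_lower R H1).
    by rewrite ler_piMl ?powR_ge0 // invf_le1 // ler1n.
  apply: (le_trans (Rcount22_upper R H1)).
  by rewrite ler_wpM2r ?powR_ge0.
- move=> n k n3 kn; have [C C0 hC] := covered_reducible_set R n3 kn.
  (* [C] is only known to be nonnegative, while a positive constant is asked for. *)
  exists (C + 1); split=> [|H H1]; first by rewrite ltr_wpDl.
  apply: (le_trans (Rcount_le (hC H H1))).
  by rewrite ler_wpM2r ?powR_ge0 // lerDl.
- move=> n k n3 kn ne; have [ko|ke] := boolP (odd k); first exact: lower_bound_odd.
  apply: lower_bound_even => //.
  have /andP[_ kn'] := kn; rewrite ltn_neqAle kn' andbT.
  by apply/eqP => E; apply: ne.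
- exact: lower_bound_full_even.
Qed.
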